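(* If $f\in h^4(\mathbf{U})$ is a nonzero complex-valued harmonic function on the unit disk $\mathbf{U}$, then $f\in b^8$ and $$\|f\|_{b^8}\le \frac{1}{2\sin\frac{\pi}{16}}\,\|f\|_{h^4}.$$
   Context: $\mathbf{U}=\{z\in\mathbb{C}:|z|<1\}$. For a complex-valued harmonic function $f$ on $\mathbf{U}$ and $0<s<\infty$, put $\|f\|_{b^s}=\left(\frac1\pi\int_{\mathbf{U}}|f(z)|^s\,dx\,dy\right)^{1/s}$ with $z=x+iy$, and $\|f\|_{h^s}=\sup_{0\le r<1}\left(\frac{1}{2\pi}\int_0^{2\pi}|f(re^{it})|^s\,dt\right)^{1/s}$. The spaces $b^s$ and $h^s=h^s(\mathbf{U})$ consist of the complex-valued harmonic functions on $\mathbf{U}$ with $\|f\|_{b^s}<\infty$ and $\|f\|_{h^s}<\infty$, respectively. *)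

(* Defs.v *)
From HB Require Import structures.
From mathcomp Require Import all_boot all_order all_algebra.
From mathcomp Require Import all_classical all_reals all_analysis.
From mathcomp Require Export complex.
Set Implicit Arguments.
Unset Strict Implicit.
Unset Printing Implicit Defensive.
Import Order.TTheory GRing.Theory Num.Theory.
Import numFieldNormedType.Exports.
Local Open Scope classical_set_scope.
Local Open Scope ring_scope.
Local Open Scope complex_scope.

Section HarmonicSpaces.
Variable R : realType.
Implicit Types (D : set (R * R)) (u : R * R -> R) (f : R[i] -> R[i]) (s : R).

(* A point x + iy of the complex plane is represented by (x, y) : R * R
   wherever real calculus or planar Lebesgue measure is needed. *)
Definition toC (p : R * R) : R[i] := p.1 +i* p.2.

Definition unit_disk : set R[i] := [set z | Normc.normc z < 1].

Definition e_x : R * R := (1, 0).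
Definition e_y : R * R := (0, 1).

(* [D] is meant to be open: derivatives and continuity at its points are those
   of [u] as a function on the whole plane. *)
Fixpoint Cn_on (n : nat) D u : Prop :=
  (forall p, D p -> {for p, continuous u}) /\
  (if n is m.+1 then
     forall v, [set e_x; e_y] v ->
       (forall p, D p -> derivable u p v) /\ Cn_on m D ('D_v u)
   else True).

Definition laplacian u (p : R * R) : R :=
  'D_e_x ('D_e_x u) p + 'D_e_y ('D_e_y u) p.

Definition real_harmonic_on D u : Prop :=
  Cn_on 2 D u /\ forall p, D p -> laplacian u p = 0.

(* The values of [f] outside [unit_disk] play no role, here or below. *)
Definition harmonic_disk f : Prop :=
  real_harmonic_on (toC @^-1` unit_disk) (fun p => complex.Re (f (toC p))) /\
  real_harmonic_on (toC @^-1` unit_disk) (fun p => complex.Im (f (toC p))).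

Local Notation mu := (@lebesgue_measure R).

Local Open Scope ereal_scope.

(* The exponent [s] is meant to be positive. *)
Definition bnorm s f : \bar R :=
  (pi^-1%:E * \int[mu \x mu]_(p in toC @^-1` unit_disk)
                (Normc.normc (f (toC p)) `^ s)%:E) `^ s^-1.

Definition circle_mean s f (r : R) : \bar R :=
  ((2 * pi)^-1%:E * \int[mu]_(t in `[0%R, (2 * pi)%R])
     (Normc.normc (f (r%:C * (cos t +i* sin t))%R) `^ s)%:E) `^ s^-1.

Definition hnorm s f : \bar R :=
  ereal_sup (circle_mean s f @` `[0%R, 1%R[).

Definition b_space s f : Prop := harmonic_disk f /\ bnorm s f < +oo.

Definition h_space s f : Prop := harmonic_disk f /\ hnorm s f < +oo.

End HarmonicSpaces.

(* Main.v *)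
(** Put w = |f|^2.  Given rho < 1, approximate w uniformly on the circle of
    radius rho, from above, by Re Q with Q a complex polynomial and Q(0) real.
    Since w is subharmonic and Re Q harmonic, w <= Re Q <= |Q| on the whole disk,
    so that the integral of |f|^8 = w^4 is at most that of |S|^2, where S = Q^2.
    If H' = S and Re H(rho) = 0, Green's formula turns the area integral of |H'|^2
    into the boundary integral of (Re H) d(Im H), whence the crude isoperimetric
    inequality: area <= length^2, with length = rho * (integral of |Q|^2 dt).
    Finally the integral of |Q|^2 over the circle is at most twice that of (Re Q)^2,
    because the mean of Re Q^2 is Q(0)^2 >= 0, and (Re Q)^2 is close to |f|^4.
    This gives |f|_{b^8}^8 <= 16 pi |f|_{h^4}^8, and 16 pi < 2^8 while
    2 sin(pi/16) <= 1/2. *)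

Require Import Defs.
From mathcomp Require Import all_boot all_order all_algebra.
From mathcomp Require Import all_classical all_reals all_analysis.
From mathcomp Require Import measurable_realfun.
From mathcomp Require Import ring lra zify.
Import Order.TTheory GRing.Theory Num.Theory.
Import numFieldNormedType.Exports.
Import HBNNSimple.
Local Open Scope ring_scope.
Set Implicit Arguments.
Unset Strict Implicit.
Unset Printing Implicit Defensive.

(** * Derivatives of complex polynomials along plane curves *)

Section CurveDerivatives.
Variable R : realType.
Local Open Scope complex_scope.
Implicit Types (q : {poly R[i]}) (x y : R -> R).

(** Squaring Q is what matches the exponents: |Q|^4 = |S|^2 is integrated over the disk, while the
    length of the boundary image under H is an integral of |S| = |Q|^2. The isoperimetric inequality
    thus trades the eighth power of |f| on the disk for the fourth power on the circle. Nothing is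
    known of f at |z| = 1, so the estimate is proved for each rho < 1 and the disk is exhausted at
    the end. Polynomials take the place of the Poisson extension of |f|^2 and of its harmonic
    conjugate: they live on the whole plane, their derivatives and primitives are again polynomials,
    and no boundary regularity has to be discussed; the price is an arbitrarily small error, removed
    by a limit. On the disk, simple functions below |f|^8 are integrated rather than |f|^8 itself.
    The constant leaves room for all this: if m bounds the h^4 norm, the length is at most 2 * 2 pi
    m^4, so the area is at most 16 pi^2 m^8, which becomes 16 pi m^8 after normalization, even
    though the isoperimetric inequality used is off by the factor 4 pi. *)

Lemma ReM (z w : R[i]) : complex.Re (z * w) =
  complex.Re z * complex.Re w - complex.Im z * complex.Im w.
Proof. by case: z w => [a b] [a' b']. Qed.

Lemma ImM (z w : R[i]) : complex.Im (z * w) =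
  complex.Re z * complex.Im w + complex.Im z * complex.Re w.
Proof. by case: z w => [a b] [a' b']. Qed.

Lemma ReD (z w : R[i]) : complex.Re (z + w) = complex.Re z + complex.Re w.
Proof. by case: z w => [a b] [a' b']. Qed.

Lemma ImD (z w : R[i]) : complex.Im (z + w) = complex.Im z + complex.Im w.
Proof. by case: z w => [a b] [a' b']. Qed.

(** The complex chain rule, split into real and imaginary parts so that only real derivatives occur.
    Induction along Horner's scheme reduces it to the Leibniz rule. Horizontal, vertical and
    circular motions are its three later uses. *)
Lemma is_derive_horner q x y (t dx dy : R) :
  is_derive t 1 x dx -> is_derive t 1 y dy ->
  is_derive t 1 (fun s => complex.Re q.[x s +i* y s])
    (complex.Re (q^`().[x t +i* y t] * (dx +i* dy))) /\
  is_derive t 1 (fun s => complex.Im q.[x s +i* y s])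
    (complex.Im (q^`().[x t +i* y t] * (dx +i* dy))).
Proof.
move=> Dx Dy; elim/poly_ind: q => [|q c [IHr IHi]].
  have -> : (fun s => complex.Re (0 : {poly R[i]}).[x s +i* y s]) = cst 0.
    by apply/funext => s; rewrite horner0.
  have -> : (fun s => complex.Im (0 : {poly R[i]}).[x s +i* y s]) = cst 0.
    by apply/funext => s; rewrite horner0.
  by rewrite deriv0 horner0 mul0r; split; exact: is_derive_cst.
pose u s := complex.Re q.[x s +i* y s].
pose v s := complex.Im q.[x s +i* y s].
have Du : is_derive t 1 u _ := IHr; have Dv : is_derive t 1 v _ := IHi.
have -> : (fun s => complex.Re (q * 'X + c%:P).[x s +i* y s]) =
    (u * x - v * y + cst (complex.Re c)).
  by apply/funext => s; rewrite !hornerE ReD ReM.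
have -> : (fun s => complex.Im (q * 'X + c%:P).[x s +i* y s]) =
    (u * y + v * x + cst (complex.Im c)).
  by apply/funext => s; rewrite !hornerE ImD ImM.
split.
  apply: is_derive_eq.
  rewrite derivMXaddC !hornerE !(ReM, ImM, ReD, ImD) /= /GRing.scale /= /u /v.
  ring.
apply: is_derive_eq.
rewrite derivMXaddC !hornerE !(ReM, ImM, ReD, ImD) /= /GRing.scale /= /u /v.
ring.
Qed.

End CurveDerivatives.

(** * Approximation on a circle by real parts of polynomials *)

Section TrigonometricApproximation.
Variable R : realType.
Local Open Scope complex_scope.
Implicit Types (s t : R) (n N : nat).

Definition cis t : R[i] := cos t +i* sin t.

Lemma cisD s t : cis (s + t) = cis s * cis t.
Proof. by rewrite /cis cosD sinD; apply/eqP; rewrite eq_complex /= eqxx addrC/= mulrC [X in _ + X]mulrC addrC eqxx. Qed.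

Lemma cis0 : cis 0 = 1.
Proof. by rewrite /cis cos0 sin0. Qed.

Lemma cisX t n : cis t ^+ n = cis (t * n%:R).
Proof.
elim: n => [|n IH]; first by rewrite mulr0 cis0.
by rewrite exprS IH -cisD mulrS mulrDr mulr1.
Qed.

(** Since 2 + 2 cos s = (1 + e^(is))^2 e^(-is), this is the real part of the binomial expansion of
    (1 + e^(is))^(2n) e^(-ins). The sum of the two truncated differences is |k - n|, a natural
    number as a polynomial degree must be. *)
Lemma half_angle_kernel s n : (2 + 2 * cos s) ^+ n =
  \sum_(k < (2 * n).+1) 'C(2 * n, k)%:R * cos (s * ((k - n) + (n - k))%N%:R).
Proof.
have H : ((2 + 2 * cos s) ^+ n)%:C =
    \sum_(k < (2 * n).+1) 'C(2 * n, k)%:R * cis (s * (k%:R - n%:R)).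
  have -> : ((2 + 2 * cos s) ^+ n)%:C = (1 + cis s) ^+ (2 * n) * cis (- s) ^+ n.
    rewrite exprM -exprMn rmorphXn/=; congr (_ ^+ n).
    have E : cis s * cis (- s) = 1 by rewrite -cisD subrr cis0.
    have -> : (1 + cis s) ^+ 2 * cis (- s) =
        cis (- s) + 2 * (cis s * cis (- s)) + cis s * (cis s * cis (- s)).
      by ring.
    rewrite E !mulr1 /cis cosN sinN; apply/eqP; rewrite eq_complex /=.
    by apply/andP; split; apply/eqP; ring.
  rewrite exprDn mulr_suml; apply: eq_bigr => k _.
  rewrite expr1n mul1r cisX -mulr_natl -mulrA; congr (_ * _).
  rewrite cisX -cisD; congr cis; ring.
have /(congr1 (@complex.Re R)) := H; rewrite /= => ->.
rewrite raddf_sum; apply: eq_bigr => k _.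
have -> : ('C(2 * n, k)%:R : R[i]) = ('C(2 * n, k)%:R)%:C by rewrite rmorph_nat.
rewrite /= mul0r subr0; congr (_ * _).
case: (leqP k n) => kn.
  rewrite (eqP kn) add0n natrB// -cosN; congr cos; ring.
have /eqP -> : (n - k == 0)%N by rewrite subn_eq0 ltnW.
by rewrite addn0 natrB// ltnW.
Qed.

(** Multiplied by 2 sin (h / 2), with h = 2 pi d / N the step of the angles, the sum telescopes over
    a whole number of periods. The bounds on d put h / 2 strictly between 0 and pi, so that this
    factor is not zero. *)
Lemma sum_cos_equispaced N d t : (0 < d < N)%N ->
  \sum_(j < N) cos ((t - 2 * pi * j%:R / N%:R) * d%:R) = 0.
Proof.
move=> /andP[d0 dN].
have N0 : (0 < N%:R :> R) by rewrite ltr0n (leq_ltn_trans _ dN).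
pose h : R := 2 * pi * d%:R / N%:R.
have sh : sin (h / 2) != 0.
  rewrite gt_eqF// sin_gt0_pi//; apply/andP; split.
    by rewrite /h !divr_gt0 ?mulr_gt0 ?pi_gt0 ?ltr0n // (leq_ltn_trans _ dN).
  rewrite /h -[ltRHS]mulr1.
  have -> : 2 * pi * d%:R / N%:R / 2 = pi * (d%:R / N%:R) :> R by field; rewrite gt_eqF.
  by rewrite ltr_pM2l ?pi_gt0// ltr_pdivrMr// mul1r ltr_nat.
pose g (j : nat) := sin (t * d%:R - h * j%:R + h / 2).
have h2 : 2 * sin (h / 2) != 0 by rewrite mulf_eq0 negb_or sh andbT pnatr_eq0.
apply: (mulfI h2).
rewrite mulr0 mulr_sumr.
rewrite (eq_bigr (fun j : 'I_N => - (g j.+1 - g j))); last first.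
  move=> j _; rewrite /g.
  have -> : t * d%:R - h * j.+1%:R + h / 2 = t * d%:R - h * j%:R - h / 2.
    by rewrite -[j.+1%:R]natr1; field.
  have -> : (t - 2 * pi * j%:R / N%:R) * d%:R = t * d%:R - h * j%:R.
    by rewrite /h; field; rewrite gt_eqF.
  by set X := (t * d%:R - h * j%:R); clearbody X; rewrite !sinD sinN cosN; ring.
rewrite sumrN -(big_mkord xpredT (fun j => g j.+1 - g j)) telescope_sumr// /g.
have -> : t * d%:R - h * N%:R + h / 2 = t * d%:R + h / 2 + - (pi *+ 2) *+ d.
  by rewrite /h -mulr_natr -(mulr_natr pi); field; rewrite gt_eqF.
rewrite mulr0 subr0.
have sinp : periodic (@sin R) (- (pi *+ 2)).
  by move=> u; rewrite -[LHS]sinD2pi subrK.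
by rewrite (periodicn sinp) subrr oppr0.
Qed.

(** All frequencies |k - n| are at most n < N, so only the constant term k = n survives the
    summation. *)
Lemma sum_half_angle_kernel N n t : (n < N)%N ->
  \sum_(j < N) (2 + 2 * cos (t - 2 * pi * j%:R / N%:R)) ^+ n =
  N%:R * 'C(2 * n, n)%:R.
Proof.
move=> nN.
under eq_bigr do rewrite half_angle_kernel.
rewrite exchange_big /=.
have n2 : (n < (2 * n).+1)%N by rewrite ltnS leq_pmull.
rewrite (bigD1 (Ordinal n2))//= subnn addn0.
under eq_bigr do rewrite mulr0 cos0 mulr1.
rewrite sumr_const card_ord big1 ?addr0; first by rewrite mulr_natl.
move=> k /negP kn.
rewrite -mulr_sumr sum_cos_equispaced ?mulr0//.
have {}kn : k != n :> nat by apply/eqP => E; apply: kn; apply/eqP/val_inj.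
have := ltn_ord k; lia.
Qed.

Lemma mul_central_bin n :
  (n.+1 * 'C(2 * n.+1, n.+1) = 2 * (2 * n).+1 * 'C(2 * n, n))%N.
Proof.
have := mul_bin_diag (2 * n.+1) n; have := mul_bin_down (2 * n).+1 n.
have -> : ((2 * n.+1).-1 = (2 * n).+1)%N by lia.
have -> : ((2 * n).+1 - n = n.+1)%N by lia.
rewrite /=; nia.
Qed.

(* Sums over the equispaced points 2 pi j / N turn the kernel
   ((1 + cos s) / 2)^n into an exact approximate identity: mean 'C(2n, n) / 4^n,
   and second moment (for 1 - cos) smaller by the factor 1 / (n + 1). *)
Lemma trigonometric_approximation (rho eps B : R) (phi : R -> R) :
  0 < rho -> 0 < eps -> (forall t, `|phi t| <= B) ->
  (forall e : R, 0 < e -> exists2 eta : R, 0 < eta &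
     forall s t, 1 - cos (t - s) < eta -> `|phi t - phi s| <= e) ->
  exists2 Q : {poly R[i]}, complex.Im Q.[0] = 0 &
    forall t, `|phi t - complex.Re Q.[rho * cos t +i* (rho * sin t)]| <= eps.
Proof.
move=> rho0 eps0 phiB unif.
have B0 : 0 <= B by rewrite (le_trans _ (phiB 0)).
have [eta eta0 near_phi] := unif (eps / 2) (divr_gt0 eps0 (ltr0n _ 2)).
(* The left-hand side is the bound that the second moment will give for the contribution of nodes
   far from t. *)
have [n nP] : exists n : nat, 2 * B / (eta * n.+1%:R) <= eps / 2.
  exists (Num.trunc (4 * B / (eta * eps))).
  have := truncnS_gt (4 * B / (eta * eps)); set m := _.+1%:R => mP.
  have m0 : 0 < m by rewrite ltr0n.
  rewrite ler_pdivrMr ?mulr_gt0//.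
  move: mP; rewrite ltr_pdivrMr ?mulr_gt0// => mP.
  nra.
(* The second moment involves the kernels of orders n and n + 1, and both sums are exact only if N >
   n + 1. *)
pose N := n.+2; pose tt (j : nat) : R := 2 * pi * j%:R / N%:R.
pose K m s : R := (2 + 2 * cos s) ^+ m.
have K0 m s : 0 <= K m s by rewrite exprn_ge0//; have := cos_geN1 s; lra.
pose c m : R := 'C(2 * m, m)%:R.
have c0 m : 0 < c m by rewrite ltr0n bin_gt0 leq_pmull.
have N0 : 0 < N%:R :> R by rewrite ltr0n.
have sumK m t : (m < N)%N -> \sum_(j < N) K m (t - tt j) = N%:R * c m.
  exact: sum_half_angle_kernel.
have cS : n.+1%:R * c n.+1 = 2 * (2 * n).+1%:R * c n.
  by rewrite /c -!natrM mul_central_bin.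
have sumK1 t : \sum_(j < N) K n (t - tt j) * (1 - cos (t - tt j)) =
    N%:R * c n / n.+1%:R.
  rewrite (eq_bigr (fun j : 'I_N => 2 * K n (t - tt j) - K n.+1 (t - tt j) / 2)); last first.
    by move=> j _; rewrite /K exprSr; field.
  rewrite sumrB -mulr_sumr -mulr_suml !sumK//.
  have n1 : n.+1%:R != 0 :> R by rewrite pnatr_eq0.
  apply: (mulIf n1); rewrite divfK//.
  have -> : (2 * (N%:R * c n) - N%:R * c n.+1 / 2) * n.+1%:R =
    2 * N%:R * c n * n.+1%:R - N%:R / 2 * (n.+1%:R * c n.+1) by ring.
  rewrite cS -[n.+1%:R]natr1 -[(2 * n).+1%:R]natr1 natrM.
  by field.
pose d k := ((k - n) + (n - k))%N.
(* Each cos ((t - tt j) d) of the kernel expansion is the real part of (z e^(-i tt j) / rho)^d at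
   the point z of angle t on the circle of radius rho. *)
pose Q0 : {poly R[i]} := \sum_(j < N) \sum_(k < (2 * n).+1)
  (phi (tt j) * 'C(2 * n, k)%:R / (N%:R * c n))%:C *:
     ((rho^-1)%:C * cis (- tt j))%:P ^+ d k * 'X ^+ d k.
pose T t := \sum_(j < N) phi (tt j) * K n (t - tt j) / (N%:R * c n).
have Q0T t : complex.Re Q0.[rho * cos t +i* (rho * sin t)] = T t.
  rewrite /Q0 horner_sum raddf_sum; apply: eq_bigr => j _.
  rewrite /K half_angle_kernel mulr_sumr mulr_suml horner_sum raddf_sum.
  apply: eq_bigr => k _.
  have rcis : (rho^-1)%:C * cis (- tt j) * (rho * cos t +i* (rho * sin t)) = cis (t - tt j).
    have -> : rho * cos t +i* (rho * sin t) = rho%:C * cis t.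
      by rewrite /cis; apply/eqP; rewrite eq_complex /= !mul0r subr0 addr0 !eqxx.
    rewrite mulrACA -rmorphM/= mulVf ?gt_eqF// mul1r mulrC -cisD//.
  rewrite !hornerE -mulrA -exprMn rcis cisX/=.
  rewrite mul0r subr0; ring.
have N0' : N%:R != 0 :> R by rewrite gt_eqF.
have c0' : c n != 0 by rewrite gt_eqF.
(* Subtracting an imaginary constant makes the value at 0 real and leaves all real parts
   unchanged. *)
exists (Q0 - (0 +i* complex.Im Q0.[0])%:P).
  by rewrite hornerD hornerN hornerC raddfB/= subrr.
move=> t; rewrite hornerD hornerN hornerC raddfB/= Q0T subr0.
have -> : phi t - T t = \sum_(j < N) (phi t - phi (tt j)) * K n (t - tt j) / (N%:R * c n).
  rewrite /T.
  under [RHS]eq_bigr do rewrite mulrBl mulrBl.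
  rewrite sumrB; congr (_ - _).
  by rewrite -mulr_suml -mulr_sumr sumK// mulfK// mulf_neq0.
(* Chebyshev's device: near nodes are handled by uniform continuity, and at far nodes the factor (1
   - cos (t - tt j)) / eta is at least 1. *)
have bnd (j : 'I_N) : `|phi t - phi (tt j)| <=
    eps / 2 + 2 * B * (1 - cos (t - tt j)) / eta.
  have c1 : 0 <= 1 - cos (t - tt j) by rewrite subr_ge0 cos_le1.
  have [close|far] := ltP (1 - cos (t - tt j)) eta.
    rewrite (le_trans (near_phi _ _ close))// lerDl.
    by apply: divr_ge0; [apply: mulr_ge0 => //; exact: mulr_ge0|exact: ltW].
  rewrite (le_trans (ler_normB _ _))// (le_trans (lerD (phiB _) (phiB _)))//.
  rewrite -mulrA.
  have : 1 <= (1 - cos (t - tt j)) / eta by rewrite ler_pdivlMr// mul1r.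
  nra.
rewrite (le_trans (ler_norm_sum _ _ _))//.
have Nc : 0 < N%:R * c n by rewrite mulr_gt0.
rewrite (le_trans (y := \sum_(j < N)
   (eps / 2 / (N%:R * c n) * K n (t - tt j) +
    2 * B / eta / (N%:R * c n) * (K n (t - tt j) * (1 - cos (t - tt j))))))//.
  apply: ler_sum => j _; rewrite !normrM (ger0_norm (K0 _ _)) (gtr0_norm (_ : 0 < _^-1)) ?invr_gt0//.
  rewrite ler_pdivrMr//.
  have -> : (eps / 2 / (N%:R * c n) * K n (t - tt j) +
    2 * B / eta / (N%:R * c n) * (K n (t - tt j) * (1 - cos (t - tt j)))) * (N%:R * c n)
   = (eps / 2 + 2 * B * (1 - cos (t - tt j)) / eta) * K n (t - tt j).
    by field; rewrite N0' c0' gt_eqF.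
  by rewrite ler_wpM2r.
rewrite big_split/= -!mulr_sumr sumK// sumK1.
have -> : eps / 2 / (N%:R * c n) * (N%:R * c n) + 2 * B / eta / (N%:R * c n) *
   (N%:R * c n / n.+1%:R) = eps / 2 + 2 * B / (eta * n.+1%:R).
  by field; rewrite N0' c0' (gt_eqF eta0) /= andbT nat1r pnatr_eq0.
by rewrite [leRHS]splitr lerD2l.
Qed.

End TrigonometricApproximation.

(** * Maximum principle for subharmonic functions on a disk *)

Section MaximumPrinciple.
Variable R : realType.
Local Open Scope classical_set_scope.
Local Open Scope complex_scope.
Implicit Types (g : R -> R) (a b c d rho : R) (p : R * R).

(** A relational form of the first two derivatives at 0: sums, multiples and squares of functions
    can be combined without rewriting nested derivatives, and [g'] has to be differentiable at 0
    only. *)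
Definition has_derivs2 g d c := exists g' : R -> R,
  [/\ \forall s \near (0 : R), is_derive s (1 : R) g (g' s), g' 0 = d & is_derive (0 : R) (1 : R) g' c].

Lemma has_derivs2D g1 g2 d1 d2 c1 c2 : has_derivs2 g1 d1 c1 ->
  has_derivs2 g2 d2 c2 -> has_derivs2 (g1 \+ g2) (d1 + d2) (c1 + c2).
Proof.
move=> [g1' [D1 <- E1]] [g2' [D2 <- E2]]; exists (g1' \+ g2'); split => //.
  by near=> s; apply: is_deriveD; near: s.
exact: is_deriveD.
Unshelve. all: by end_near. Qed.

Lemma has_derivs2Z a g d c : has_derivs2 g d c ->
  has_derivs2 (fun s => a * g s) (a * d) (a * c).
Proof.
move=> [g' [D <- E]]; exists (fun s => a * g' s); split => //.
  by near=> s; apply: is_deriveZ; near: s.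
exact: is_deriveZ.
Unshelve. all: by end_near. Qed.

Lemma has_derivs2X g d c : has_derivs2 g d c ->
  has_derivs2 (fun s => g s ^+ 2) (2 * g 0 * d) (2 * d ^+ 2 + 2 * g 0 * c).
Proof.
move=> [g' [D <- E]]; exists (fun s => 2 * g s * g' s); split => //.
  near=> s; have Ds : is_derive s (1 : R) g (g' s) by near: s.
  have -> : (fun s => g s ^+ 2) = g ^+ 2 by apply/funext.
  by apply: is_derive_eq; rewrite /GRing.scale /= expr1 -mulr_natl; ring.
have D0 : is_derive (0 : R) (1 : R) g (g' 0) by exact: nbhs_singleton D.
have -> : (fun s => 2 * g s * g' s) = (2 \*: (g * g')).
  by apply/funext => s; rewrite -mulrA.
by apply: is_derive_eq; rewrite /GRing.scale /=; ring.
Unshelve. all: by end_near. Qed.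

(** The first derivative vanishes at the maximum. Were c > 0, it would be positive just to the right
    of 0, and the mean value theorem would give a value above [g 0]. *)
Lemma local_max_derivs2 g d c : has_derivs2 g d c ->
  (\forall s \near (0 : R), g s <= g 0) -> c <= 0.
Proof.
move=> [g' [D _ E]] gmax.
have D0 : is_derive (0 : R) (1 : R) g (g' 0) by exact: nbhs_singleton D.
have [e1 /= e10 P1] := D; have [e2 /= e20 P2] := gmax.
have {}P1 (s : R) : `|s| < e1 -> is_derive s 1 g (g' s).
  by move=> se; apply: P1; rewrite /ball_/= sub0r normrN.
have {}P2 s : `|s| < e2 -> g s <= g 0.
  by move=> se; apply: P2; rewrite /ball_/= sub0r normrN.
have g'0 : g' 0 = 0.
  pose r := Num.min e1 e2; have r0 : 0 < r by rewrite lt_min e10.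
  have rN : - r <= r by lra.
  have in0 : 0 \in `]-r, r[%R by rewrite in_itv/= oppr_lt0 r0.
  have inr s : s \in `]-r, r[%R -> `|s| < r by rewrite in_itv/= ltr_norml.
  have : is_derive (0 : R) (1 : R) g 0.
    apply: (derive1_at_max rN _ in0) => s /inr; rewrite lt_min => /andP[? ?].
      by apply: ex_derive; exact: P1.
    exact: P2.
  by move=> /@derive_val; rewrite (@derive_val _ _ _ _ _ _ _ D0).
rewrite leNgt; apply/negP => c0.
have [e3 /= e30 P3] : \forall h \near (0 : R)^', 0 < h^-1 * g' h.
  have := @ex_derive _ _ _ _ _ _ _ E; rewrite /derivable.
  have := @derive_val _ _ _ _ _ _ _ E; rewrite /derive => -> /cvgr_gt => /(_ _ c0).
  apply: filterS => h /=; rewrite g'0 subr0 addr0 /GRing.scale/= mulr1//.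
pose b := Num.min e1 (Num.min e2 e3) / 2.
have b0 : 0 < b by rewrite divr_gt0// !lt_min e10 e20.
have : b < Num.min e1 (Num.min e2 e3) by rewrite /b; move: b0; rewrite /b; lra.
rewrite !lt_min => /and3P[b1 b2 b3].
have small s : 0 <= s <= b -> `|s| < e1.
  by move=> /andP[s0 sb]; rewrite ger0_norm// (le_lt_trans sb).
have [] := @MVT _ g g' 0 b b0.
- by move=> s; rewrite in_itv/= => /andP[s0 sb]; apply: P1; apply: small; rewrite !ltW.
- apply: derivable_within_continuous => s; rewrite in_itv/= => /small /P1 H.
  exact: ex_derive.
move=> s; rewrite in_itv/= => /andP[s0 sb] gb.
have : g b <= g 0 by apply: P2; rewrite gtr0_norm.
have : 0 < s^-1 * g' s.
  apply: P3; last by rewrite gt_eqF.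
  by rewrite /ball_/= sub0r normrN gtr0_norm// (lt_trans sb).
rewrite pmulr_rgt0 ?invr_gt0// => g's.
by rewrite -subr_le0 gb leNgt subr0 mulr_gt0.
Qed.

Definition closed_disk rho : set (R * R) :=
  [set p | p.1 ^+ 2 + p.2 ^+ 2 <= rho ^+ 2].

Lemma continuous_sqr_dist : continuous (fun p => p.1 ^+ 2 + p.2 ^+ 2).
Proof.
move=> p; apply: cvgD; apply: cvgM; try exact: cvg_fst; exact: cvg_snd.
Qed.

Lemma compact_closed_disk rho : 0 <= rho -> compact (closed_disk rho).
Proof.
move=> rho0.
apply: (@subclosed_compact _ _ (`[-rho, rho] `*` `[-rho, rho])).
- apply: (@closed_comp _ _ (fun p : R * R => p.1 ^+ 2 + p.2 ^+ 2) [set x | x <= rho ^+ 2]).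
    by move=> p _; exact: continuous_sqr_dist.
  exact: closed_le.
- by apply: compact_setX; exact: segment_compact.
- move=> [x y]; rewrite /closed_disk/= => H; rewrite !in_itv/=.
  by split; apply/andP; nra.
Qed.

Lemma polar_angle rho p : 0 < rho -> p.1 ^+ 2 + p.2 ^+ 2 = rho ^+ 2 ->
  exists2 t, - pi <= t <= pi & p = (rho * cos t, rho * sin t).
Proof.
move=> rho0 E; case: p E => x y /= E.
have xr : -1 <= x / rho <= 1.
  by rewrite ler_pdivlMr// ler_pdivrMr// mulN1r mul1r; apply/andP; nra.
have rn0 : rho != 0 by rewrite gt_eqF.
have sq : 1 - (x / rho) ^+ 2 = (y / rho) ^+ 2.
  by apply: (mulIf (expf_neq0 2 rn0)); rewrite !expr_div_n mulrBl !divfK ?expf_neq0// mul1r -E addrC addKr.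
have [y0|y0] := leP 0 y.
  exists (acos (x / rho)).
    by rewrite acos_lepi// andbT (@le_trans _ _ 0) ?acos_ge0// oppr_le0 pi_ge0.
  rewrite acosK// sin_acos// sq sqrtr_sqr.
  rewrite ger0_norm; last by apply: divr_ge0 => //; exact: ltW.
  by rewrite ![rho * _]mulrC !divfK.
exists (- acos (x / rho)).
  by rewrite lerN2 acos_lepi//= (@le_trans _ _ 0) ?pi_ge0// oppr_le0 acos_ge0.
rewrite cosN sinN acosK// sin_acos// sq sqrtr_sqr.
rewrite ltr0_norm ?opprK; first by rewrite ![rho * _]mulrC !divfK.
by rewrite ltr_pdivrMr// mul0r.
Qed.

(** Adding del * x^2 makes the sum of the second derivatives strictly positive, which excludes an
    interior maximum; the maximum over the compact disk therefore lies on the circle. *)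
Lemma maximum_principle rho (v : R * R -> R) (m : R) : 0 < rho ->
  {within closed_disk rho, continuous v} ->
  (forall p, p.1 ^+ 2 + p.2 ^+ 2 < rho ^+ 2 -> exists dx cx dy cy,
    [/\ has_derivs2 (fun s => v (p.1 + s, p.2)) dx cx,
        has_derivs2 (fun s => v (p.1, p.2 + s)) dy cy & 0 <= cx + cy]) ->
  (forall t, v (rho * cos t, rho * sin t) <= m) ->
  forall p, closed_disk rho p -> v p <= m.
Proof.
move=> rho0 cv sub bd p0 Kp0; apply/ler_addgt0Pr => e e0.
(* With this choice the perturbation del * x^2 is at most e on the disk. *)
pose del := e / rho ^+ 2.
have del0 : 0 < del by rewrite divr_gt0// exprn_gt0.
pose w p := v p + del * p.1 ^+ 2.
have cw : {within closed_disk rho, continuous w}.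
  have cq : continuous (fun p : R * R => del * p.1 ^+ 2).
    by move=> p; apply: cvgM; [exact: cvg_cst|apply: cvgM; exact: cvg_fst].
  by move=> p; apply: cvgD; [exact: cv|exact: (continuous_subspaceT cq)].
have K0 : closed_disk rho !=set0 by exists p0.
have [p] := compact_EVT_max K0 (compact_closed_disk (ltW rho0)) cw.
rewrite inE => Kp pmax.
have {}pmax q : closed_disk rho q -> w q <= w p by move=> Kq; apply: pmax; rewrite inE.
have wp : w p <= m + e.
  have [inn|out] := ltP (p.1 ^+ 2 + p.2 ^+ 2) (rho ^+ 2); last first.
    have /(polar_angle rho0)[t _ pE] : p.1 ^+ 2 + p.2 ^+ 2 = rho ^+ 2 by apply/eqP; rewrite eq_le Kp.
    have -> : e = del * rho ^+ 2 by rewrite divfK// expf_neq0// gt_eqF.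
    apply: lerD; first by rewrite pE.
    apply: ler_wpM2l; first exact: ltW.
    by apply: le_trans Kp; rewrite lerDl sqr_ge0.
  have [dx [cx [dy [cy [Hx Hy cxy]]]]] := sub p inn.
  exfalso.
  have Hq : has_derivs2 (fun s => del * (p.1 + s) ^+ 2) (del * (2 * (p.1 + 0) * 1))
      (del * (2 * 1 ^+ 2 + 2 * (p.1 + 0) * 0)).
    apply: has_derivs2Z; apply: (has_derivs2X (g := fun s => p.1 + s)).
    exists (fun=> 1); split => //; last exact: is_derive_cst.
    near=> s; rewrite (_ : (fun r => _) = cst p.1 + id)//.
    by apply: is_derive_eq; rewrite add0r.
  have cx0 : cx + del * 2 <= 0.
    rewrite (_ : cx + _ = cx + (del * (2 * 1 ^+ 2 + 2 * (p.1 + 0) * 0))); last by ring.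
    apply: (local_max_derivs2 (has_derivs2D Hx Hq)).
    near=> s; rewrite /= addr0.
    have : w (p.1 + s, p.2) <= w p.
      apply: pmax; rewrite /closed_disk/= ltW//; near: s.
      have : (fun s => (p.1 + s) ^+ 2 + p.2 ^+ 2) @ (0 : R) --> (p.1 + 0) ^+ 2 + p.2 ^+ 2.
        apply: cvgD; last exact: cvg_cst.
        by apply: cvgM; (apply: cvgD; [exact: cvg_cst|exact: cvg_id]).
      by move=> /cvgr_lt; apply; rewrite addr0.
    by rewrite /w/=; case: (p).
  have cy0 : cy <= 0.
    apply: (local_max_derivs2 Hy).
    near=> s; rewrite /= addr0.
    have : w (p.1, p.2 + s) <= w p.
      apply: pmax; rewrite /closed_disk/= ltW//; near: s.
      have : (fun s => p.1 ^+ 2 + (p.2 + s) ^+ 2) @ (0 : R) --> p.1 ^+ 2 + (p.2 + 0) ^+ 2.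
        apply: cvgD; first exact: cvg_cst.
        by apply: cvgM; (apply: cvgD; [exact: cvg_cst|exact: cvg_id]).
      by move=> /cvgr_lt; apply; rewrite addr0.
    by rewrite /w/= lerD2r; case: (p).
  lra.
rewrite (le_trans _ wp)// (le_trans _ (pmax _ Kp0))// /w lerDl mulr_ge0 ?sqr_ge0// ltW//.
Unshelve. all: by end_near. Qed.

End MaximumPrinciple.

(** * Harmonic polynomial majorants of |f|^2 *)

Section HarmonicMajorant.
Variable R : realType.
Local Open Scope classical_set_scope.
Local Open Scope complex_scope.
Implicit Types (p v : R * R) (u : R * R -> R) (Q : {poly R[i]}) (f : R[i] -> R[i]).

Lemma mem_unit_disk p :
  (@toC R @^-1` (@unit_disk R)) p <-> p.1 ^+ 2 + p.2 ^+ 2 < 1.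
Proof.
by rewrite /unit_disk/= /toC/= -[X in _ < X]sqrtr1 ltr_sqrt ?ltr01.
Qed.

Lemma sqr_normc (z : R[i]) :
  Normc.normc z ^+ 2 = complex.Re z ^+ 2 + complex.Im z ^+ 2.
Proof. by case: z => a b; rewrite /= sqr_sqrtr// addr_ge0// sqr_ge0. Qed.

Lemma is_derive_line u p v (s : R) : derivable u (p + s *: v) v ->
  is_derive s (1 : R) (fun r => u (p + r *: v)) ('D_v u (p + s *: v)).
Proof.
move=> Du.
have E : (fun h : R => h^-1 *: (((fun r => u (p + r *: v)) \o shift s) (h *: (1 : R)) - u (p + s *: v))) =
    (fun h : R => h^-1 *: ((u \o shift (p + s *: v)) (h *: v) - u (p + s *: v))).
  apply/funext => h /=; congr (_ *: (u _ - _)).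
  by rewrite [h *: 1]mulr1 scalerDl addrCA.
by apply: DeriveDef; [rewrite /derivable E|rewrite /derive E].
Qed.

Lemma near_unit_disk_line p v : p.1 ^+ 2 + p.2 ^+ 2 < 1 ->
  \forall s \near (0 : R), (@toC R @^-1` (@unit_disk R)) (p + s *: v).
Proof.
move=> p1.
have : (fun s : R => (p.1 + s * v.1) ^+ 2 + (p.2 + s * v.2) ^+ 2) @ (0 : R) -->
    (p.1 + 0 * v.1) ^+ 2 + (p.2 + 0 * v.2) ^+ 2.
  by apply: cvgD; apply: cvgM; (apply: cvgD; [exact: cvg_cst|apply: cvgM; [exact: cvg_id|exact: cvg_cst]]).
rewrite !mul0r !addr0 => /cvgr_lt/(_ _ p1); apply: filterS => s sp.
exact/mem_unit_disk.
Qed.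

Lemma C2_derivs2 u p v : [set e_x R; e_y R] v ->
  Cn_on 2 (@toC R @^-1` (@unit_disk R)) u -> p.1 ^+ 2 + p.2 ^+ 2 < 1 ->
  has_derivs2 (fun s => u (p + s *: v)) ('D_v u p) ('D_v ('D_v u) p).
Proof.
move=> ve [_ /(_ _ ve)[Du [_ /(_ _ ve)[DDu _]]]] p1.
exists (fun s => 'D_v u (p + s *: v)); split.
- near=> s; apply: is_derive_line; apply: Du; near: s; exact: near_unit_disk_line.
- by rewrite scale0r addr0.
- have := @is_derive_line ('D_v u) p v 0; rewrite scale0r addr0; apply; apply: DDu.
  exact/mem_unit_disk.
Unshelve. all: by end_near. Qed.

Lemma horner_derivs2_x Q p : has_derivs2
  (fun s => complex.Re Q.[(p.1 + s) +i* p.2])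
  (complex.Re Q^`().[toC p]) (complex.Re Q^`()^`().[toC p]).
Proof.
have D (q : {poly R[i]}) (s : R) : is_derive s (1 : R)
    (fun s => complex.Re q.[(p.1 + s) +i* p.2]) (complex.Re q^`().[(p.1 + s) +i* p.2]).
  have dx : is_derive s (1 : R) (cst p.1 + id) (0 + 1) by exact: is_deriveD.
  have [+ _] := is_derive_horner q dx (is_derive_cst p.2 s (1 : R)).
  by rewrite add0r -[_ +i* 0]/(1%:C) mulr1.
exists (fun s => complex.Re Q^`().[(p.1 + s) +i* p.2]); split.
- by near=> s; exact: D.
- by rewrite addr0.
- by have := D (deriv Q) 0; rewrite addr0.
Unshelve. all: by end_near. Qed.

Lemma horner_derivs2_y Q p : has_derivs2
  (fun s => complex.Re Q.[p.1 +i* (p.2 + s)])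
  (- complex.Im Q^`().[toC p]) (- complex.Re Q^`()^`().[toC p]).
Proof.
have D (q : {poly R[i]}) (s : R) : is_derive s (1 : R)
    (fun s => complex.Re q.[p.1 +i* (p.2 + s)]) (- complex.Im q^`().[p.1 +i* (p.2 + s)]) /\
  is_derive s (1 : R)
    (fun s => complex.Im q.[p.1 +i* (p.2 + s)]) (complex.Re q^`().[p.1 +i* (p.2 + s)]).
  have dx : is_derive s (1 : R) (cst p.2 + id) (0 + 1) by exact: is_deriveD.
  have := is_derive_horner q (is_derive_cst p.1 s (1 : R)) dx.
  rewrite add0r; case: ((deriv q).[_]) => a b /=.
  by rewrite !(mulr0, mulr1, sub0r, addr0).
exists (fun s => - complex.Im Q^`().[p.1 +i* (p.2 + s)]); split.
- by near=> s; have [] := D Q s.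
- by rewrite addr0.
- have [_] := D (deriv Q) 0; rewrite addr0 => H.
  exact: is_deriveN.
Unshelve. all: by end_near. Qed.

Lemma continuous_horner Q :
  continuous (fun p => complex.Re Q.[toC p]) /\
  continuous (fun p => complex.Im Q.[toC p]).
Proof.
elim/poly_ind: Q => [|q c [Cr Ci]].
  by split=> p; under eq_fun do rewrite horner0; exact: cvg_cst.
split=> p.
  have -> : (fun p => complex.Re (q * 'X + c%:P).[toC p]) =
     (fun p => complex.Re q.[toC p] * p.1 - complex.Im q.[toC p] * p.2 + complex.Re c).
    apply/funext => -[x y]; rewrite !hornerE /toC/=.
    by case: c (q.[_]) => [c c'] [a b] /=.
  apply: cvgD; last exact: cvg_cst.
  by apply: cvgB; apply: cvgM; [exact: Cr|exact: cvg_fst|exact: Ci|exact: cvg_snd].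
have -> : (fun p => complex.Im (q * 'X + c%:P).[toC p]) =
   (fun p => complex.Re q.[toC p] * p.2 + complex.Im q.[toC p] * p.1 + complex.Im c).
  apply/funext => -[x y]; rewrite !hornerE /toC/=.
  by case: c (q.[_]) => [c c'] [a b] /=.
apply: cvgD; last exact: cvg_cst.
by apply: cvgD; apply: cvgM; [exact: Cr|exact: cvg_snd|exact: Ci|exact: cvg_fst].
Qed.

(** This is the Laplacian of u^2 + v^2 - Re Q, in the form produced by [has_derivs2]: x and y are
    the values of u and v, the d's their first derivatives, the a's and b's their second ones, and
    c, -c those of Re Q. For harmonic u and v only twice the squared gradients remain. *)
Lemma laplacian_sum_sqr_ge0 (x y d1 d2 d3 d4 a1 a2 b1 b2 c : R) :
  a1 + a2 = 0 -> b1 + b2 = 0 ->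
  0 <= 2 * d1 ^+ 2 + 2 * x * a1 + (2 * d2 ^+ 2 + 2 * y * b1) + -1 * c +
      (2 * d3 ^+ 2 + 2 * x * a2 + (2 * d4 ^+ 2 + 2 * y * b2) + -1 * - c).
Proof.
move=> /eqP; rewrite addr_eq0 => /eqP -> /eqP; rewrite addr_eq0 => /eqP ->.
have := sqr_ge0 d1; have := sqr_ge0 d2; have := sqr_ge0 d3; have := sqr_ge0 d4.
lra.
Qed.

Lemma sqr_normc_majorant f Q rho : 0 < rho < 1 -> harmonic_disk f ->
  (forall t, Normc.normc (f (rho * cos t +i* (rho * sin t))) ^+ 2 <=
     complex.Re Q.[rho * cos t +i* (rho * sin t)]) ->
  forall p, closed_disk rho p ->
    Normc.normc (f (toC p)) ^+ 2 <= complex.Re Q.[toC p].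
Proof.
move=> /andP[rho0 rho1] [[Cu Lu] [Cv Lv]] bd p Kp.
set u := (fun p => complex.Re (f (toC p))) in Cu Lu.
set v := (fun p => complex.Im (f (toC p))) in Cv Lv.
rewrite sqr_normc -subr_le0.
pose w q := (u q ^+ 2 + v q ^+ 2) + -1 * complex.Re Q.[toC q].
have rho2 : rho ^+ 2 < 1 by rewrite expr_lt1// ltW.
suff : w p <= 0 by rewrite /w mulN1r.
apply: (maximum_principle rho0 _ _ _ Kp).
- apply: continuous_in_subspaceT => q; rewrite inE => Kq.
  have Dq : (@toC R @^-1` (@unit_disk R)) q.
    by apply/mem_unit_disk; exact: le_lt_trans Kq rho2.
  apply: cvgD; last by apply: cvgM; [exact: cvg_cst|exact: (continuous_horner Q).1].
  by apply: cvgD; apply: cvgM; [exact: Cu.1|exact: Cu.1|exact: Cv.1|exact: Cv.1].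
- move=> q q1; have {}q1 : q.1 ^+ 2 + q.2 ^+ 2 < 1 by exact: lt_trans q1 rho2.
  have Ex s : (q.1 + s, q.2) = q + s *: e_x R.
    by case: q {q1} => x y; congr (_, _); rewrite /= ?[s *: _]mulr1 ?[s *: _]mulr0 ?addr0.
  have Ey s : (q.1, q.2 + s) = q + s *: e_y R.
    by case: q {q1 Ex} => x y; congr (_, _); rewrite /= ?[s *: _]mulr1 ?[s *: _]mulr0 ?addr0.
  have exS : [set e_x R; e_y R] (e_x R) by left.
  have eyS : [set e_x R; e_y R] (e_y R) by right.
  have ux := has_derivs2X (C2_derivs2 exS Cu q1).
  have uy := has_derivs2X (C2_derivs2 eyS Cu q1).
  have vx := has_derivs2X (C2_derivs2 exS Cv q1).
  have vy := has_derivs2X (C2_derivs2 eyS Cv q1).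
  have wx := has_derivs2D (has_derivs2D ux vx) (has_derivs2Z (-1) (horner_derivs2_x Q q)).
  have wy := has_derivs2D (has_derivs2D uy vy) (has_derivs2Z (-1) (horner_derivs2_y Q q)).
  have -> : (fun s => w (q.1 + s, q.2)) = (fun s => u (q + s *: e_x R) ^+ 2) \+
     (fun s => v (q + s *: e_x R) ^+ 2) \+ (fun s => -1 * complex.Re Q.[(q.1 + s) +i* q.2]).
    by apply/funext => s; rewrite /= -Ex.
  have -> : (fun s => w (q.1, q.2 + s)) = (fun s => u (q + s *: e_y R) ^+ 2) \+
     (fun s => v (q + s *: e_y R) ^+ 2) \+ (fun s => -1 * complex.Re Q.[q.1 +i* (q.2 + s)]).
    by apply/funext => s; rewrite /= -Ey.
  do 4 eexists; split; [exact: wx|exact: wy|].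
  have Dq : (@toC R @^-1` (@unit_disk R)) q by exact/mem_unit_disk.
  have := Lu _ Dq; have := Lv _ Dq; rewrite /laplacian => Hv Hu.
  rewrite !scale0r !addr0.
  exact: laplacian_sum_sqr_ge0 Hu Hv.
- move=> t; rewrite /w mulN1r subr_le0 -sqr_normc; exact: bd.
Qed.

End HarmonicMajorant.

(** * One-dimensional integrals and parametrization of the circle *)

Section Integration.
Variable R : realType.
Local Notation mu := (@lebesgue_measure R).
Local Open Scope classical_set_scope.
Implicit Types (f g F G : R -> R) (a b rho : R).

Lemma integral_is_derive f F a b : a <= b -> continuous f ->
  (forall x, a <= x <= b -> is_derive x (1 : R) F (f x)) ->
  (\int[mu]_(x in `[a, b]) (f x)%:E = (F b - F a)%:E)%E.
Proof.
rewrite le_eqVlt => /predU1P[<- _ _|ab cf DF].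
  by rewrite set_itv1 integral_set1 subrr.
have cF x : a <= x <= b -> {for x, continuous F}.
  move=> /DF Dx; apply: differentiable_continuous; apply/derivable1_diffP.
  exact: ex_derive.
rewrite (@continuous_FTC2 _ f F)//.
- exact: continuous_subspaceT.
- split.
  + move=> x; rewrite in_itv/= => /andP[ax xb].
    have Dx : is_derive x (1 : R) F (f x) by apply: DF; rewrite !ltW.
    exact: ex_derive.
  + by apply: cvg_at_right_filter; apply: cF; rewrite lexx ltW.
  + by apply: cvg_at_left_filter; apply: cF; rewrite lexx ltW.
- move=> x; rewrite in_itv/= => /andP[ax xb].
  have Dx : is_derive x (1 : R) F (f x) by apply: DF; rewrite !ltW.
  by rewrite derive1E derive_val.
Qed.

Lemma continuous_itv_integrable g a b : continuous g ->
  mu.-integrable `[a, b] (EFin \o g).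
Proof.
move=> cg; apply: continuous_compact_integrable; first exact: segment_compact.
exact: continuous_subspaceT.
Qed.

Lemma primitive_exists g (M : R) : continuous g -> exists G : R -> R,
  forall x, - M < x < M -> is_derive x (1 : R) G (g x).
Proof.
move=> cg; exists (fun x => (\int[mu]_(t in `[(- M)%R, x]) g t)%R) => x /andP[x1 x2].
have ig : mu.-integrable `[- M, M] (EFin \o g) by exact: continuous_itv_integrable.
have [D E] := continuous_FTC1_closed x2 ig x1 (cg x).
apply: DeriveDef; first exact: D.
by rewrite -derive1E; exact: E.
Qed.

(** Changes of variables below are made by comparing primitives: F - G has zero derivative, hence
    equal end values by the mean value theorem. *)
Lemma eq_increment F G (h : R -> R) a b : a <= b ->
  (forall x, a <= x <= b -> {for x, continuous F}) ->
  (forall x, a <= x <= b -> {for x, continuous G}) ->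
  (forall x, a < x < b -> is_derive x (1 : R) F (h x)) ->
  (forall x, a < x < b -> is_derive x (1 : R) G (h x)) ->
  F b - F a = G b - G a.
Proof.
rewrite le_eqVlt => /predU1P[<- _ _ _ _|ab cF cG DF DG]; first by rewrite !subrr.
have [] := @MVT _ (F - G) (fun=> 0) a b ab.
- move=> x; rewrite in_itv/= => xab; rewrite -(subrr (h x)).
  by apply: is_deriveB; [exact: DF|exact: DG].
- apply: continuous_in_subspaceT => x; rewrite inE/= in_itv/= => xab.
  by apply: cvgB; [exact: cF|exact: cG].
move=> c _; rewrite mul0r !fctE => /eqP; rewrite subr_eq0 => /eqP E; lra.
Qed.

(** The square root is 0 on negative numbers, so this function is continuous on the whole line and
    vanishes for |x| > rho. *)
Definition half_chord (rho x : R) : R := Num.sqrt (rho ^+ 2 - x ^+ 2).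

Lemma continuous_half_chord rho : continuous (half_chord rho).
Proof.
rewrite (_ : half_chord rho = @Num.sqrt R \o (fun x => rho ^+ 2 - x ^+ 2))// => x.
apply: continuous_comp; last exact: sqrt_continuous.
by apply: cvgB; [exact: cvg_cst|apply: cvgM; exact: cvg_id].
Qed.

Lemma half_chord_cos rho t : 0 <= rho -> half_chord rho (rho * cos t) = rho * `|sin t|.
Proof.
move=> rho0; rewrite /half_chord.
have -> : rho ^+ 2 - (rho * cos t) ^+ 2 = (rho * sin t) ^+ 2.
  by rewrite !exprMn sin2cos2; ring.
by rewrite sqrtr_sqr normrM ger0_norm.
Qed.

Lemma half_chord_sin rho t : 0 <= rho -> half_chord rho (rho * sin t) = rho * `|cos t|.
Proof.
move=> rho0; rewrite /half_chord.
have -> : rho ^+ 2 - (rho * sin t) ^+ 2 = (rho * cos t) ^+ 2.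
  by rewrite !exprMn cos2sin2; ring.
by rewrite sqrtr_sqr normrM ger0_norm.
Qed.

Lemma continuous_pair2 (B : R * R -> R) (u v : R -> R) : continuous B ->
  continuous u -> continuous v -> continuous (fun x => B (u x, v x)).
Proof.
move=> cB cu cv x; apply: (@continuous_comp _ _ _ (fun x => (u x, v x)) B).
  exact: (cvg_pair (cu x) (cv x)).
exact: cB.
Qed.

Lemma continuous_mulc a (u : R -> R) : continuous u -> continuous (fun t => a * u t).
Proof. by move=> cu t; apply: cvgM; [exact: cvg_cst|exact: cu]. Qed.

Lemma is_derive_continuous F x (d : R) :
  is_derive x (1 : R) F d -> {for x, continuous F}.
Proof.
move=> Dx; apply: differentiable_continuous; apply/derivable1_diffP.
exact: ex_derive.
Qed.

Lemma norm_rho_trig rho (c : R) : 0 < rho -> `|c| <= 1 ->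
  - (rho + 1) < rho * c < rho + 1.
Proof.
move=> rho0; rewrite ler_norml => /andP[c1 c2]; apply/andP; nra.
Qed.

(** The substitution x = rho cos t is monotone only on half circles. On [0, pi] the sine is
    nonnegative and the point lies on the upper arc; on [pi, 2 pi] it lies on the lower one. *)
Lemma circle_integral_y rho (B : R * R -> R) : 0 < rho -> continuous B ->
  (\int[mu]_(x in `[(- rho)%R, rho])
     (B (x, half_chord rho x) - B (x, - half_chord rho x))%:E =
   \int[mu]_(t in `[0%R, (2 * pi)%R])
     (B (rho * cos t, rho * sin t) * (rho * sin t))%:E)%E.
Proof.
move=> rho0 cB.
have cs := @continuous_half_chord rho.
have csN : continuous (fun x => - half_chord rho x) by move=> x; apply: cvgN; exact: cs.
have cid : continuous (@id R) by move=> x; exact: cvg_id.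
have c1 := continuous_pair2 cB cid cs.
have c2 := continuous_pair2 cB cid csN.
have [G1 D1] := primitive_exists (rho + 1) c1.
have [G2 D2] := primitive_exists (rho + 1) c2.
have cc := continuous_mulc (a := rho) (@continuous_cos R).
have csn := continuous_mulc (a := rho) (@continuous_sin R).
have ch : continuous (fun t => B (rho * cos t, rho * sin t) * (rho * sin t)).
  move=> t; apply: cvgM; last exact: csn.
  exact: (continuous_pair2 cB cc csn).
(* Any bound above 2 pi would do; 10 suffices because pi < 5. *)
have [H DH] := primitive_exists 10 ch.
have pi0 := pi_gt0 R; have pi4 : pi < 5 :> R.
  by have := pihalf_lt2 R; lra.
etransitivity; first apply: (@integral_is_derive _ (G1 - G2)).
- lra.
- by move=> x; apply: cvgB; [exact: c1|exact: c2].
- move=> x /andP[x1 x2]; apply: is_deriveB; [apply: D1|apply: D2]; apply/andP; lra.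
apply: esym; etransitivity; first apply: (@integral_is_derive _ H).
- lra.
- exact: ch.
- by move=> x /andP[x1 x2]; apply: DH; apply/andP; lra.
have DG (G g : R -> R) t : (forall x, - (rho + 1) < x < rho + 1 -> is_derive x (1 : R) G (g x)) ->
    is_derive t (1 : R) (fun t => - G (rho * cos t)) (g (rho * cos t) * (rho * sin t)).
  move=> DG.
  have /DG DGt : - (rho + 1) < rho * cos t < rho + 1.
    by apply: norm_rho_trig => //; rewrite ler_norml cos_geN1 cos_le1.
  have Dc : is_derive t (1 : R) (fun t => rho * cos t) (rho * - sin t) by exact: is_deriveZ.
  have DD : is_derive t (1 : R) (G \o (fun t => rho * cos t)) (g (rho * cos t) * (rho * - sin t)).
    exact: is_derive1_comp.
  rewrite (_ : g _ * (rho * sin t) = - (g (rho * cos t) * (rho * - sin t))); last first.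
    by rewrite !mulrN opprK.
  exact: is_deriveN.
have E1 : H pi - H 0 = - G1 (rho * cos pi) - - G1 (rho * cos 0).
  apply: (@eq_increment H (fun t => - G1 (rho * cos t)) _ 0 pi (ltW pi0)).
  - move=> x /andP[x1 x2]; apply: is_derive_continuous; apply: DH; apply/andP; lra.
  - move=> x _; apply: is_derive_continuous; exact: (DG _ _ _ D1).
  - move=> x /andP[x1 x2]; apply: DH; apply/andP; lra.
  - move=> x /andP[x1 x2]; have := DG _ _ x D1.
    by rewrite half_chord_cos ?ltW// ger0_norm// sin_ge0_pi// !ltW.
have E2 : H (2 * pi) - H pi = - G2 (rho * cos (2 * pi)) - - G2 (rho * cos pi).
  have pi2 : pi <= 2 * pi :> R by lra.
  apply: (@eq_increment H (fun t => - G2 (rho * cos t)) _ pi (2 * pi) pi2).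
  - move=> x /andP[x1 x2]; apply: is_derive_continuous; apply: DH; apply/andP; lra.
  - move=> x _; apply: is_derive_continuous; exact: (DG _ _ _ D2).
  - move=> x /andP[x1 x2]; apply: DH; apply/andP; lra.
  - move=> x /andP[x1 x2]; have := DG _ _ x D2.
    rewrite half_chord_cos ?ltW// ler0_norm ?mulrN ?opprK//.
    have -> : x = (x - pi) + pi by ring.
    rewrite sinDpi oppr_le0 sin_ge0_pi//; apply/andP; lra.
congr EFin; rewrite !fctE.
have -> : H (2 * pi) - H 0 = (H (2 * pi) - H pi) + (H pi - H 0) by ring.
rewrite E1 E2 cospi cos0 mulr1 mulrN1 [2 * pi]mulr_natl cos2pi mulr1; ring.
Qed.

(** As for the other coordinate, but the right half circle contains the angle 0: it is cut into
    [0, pi / 2] and [3 pi / 2, 2 pi], and three arcs are compared instead of two. *)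
Lemma circle_integral_x rho (A : R * R -> R) : 0 < rho -> continuous A ->
  (\int[mu]_(y in `[(- rho)%R, rho])
     (A (half_chord rho y, y) - A (- half_chord rho y, y))%:E =
   \int[mu]_(t in `[0%R, (2 * pi)%R])
     (A (rho * cos t, rho * sin t) * (rho * cos t))%:E)%E.
Proof.
move=> rho0 cA.
have cs := @continuous_half_chord rho.
have csN : continuous (fun x => - half_chord rho x) by move=> x; apply: cvgN; exact: cs.
have cid : continuous (@id R) by move=> x; exact: cvg_id.
have c1 := continuous_pair2 cA cs cid.
have c2 := continuous_pair2 cA csN cid.
have [G1 D1] := primitive_exists (rho + 1) c1.
have [G2 D2] := primitive_exists (rho + 1) c2.
have cc := continuous_mulc (a := rho) (@continuous_cos R).
have csn := continuous_mulc (a := rho) (@continuous_sin R).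
have ch : continuous (fun t => A (rho * cos t, rho * sin t) * (rho * cos t)).
  move=> t; apply: cvgM; last exact: cc.
  exact: (continuous_pair2 cA cc csn).
have [H DH] := primitive_exists 10 ch.
have pi0 := pi_gt0 R; have pi4 : pi < 5 :> R.
  by have := pihalf_lt2 R; lra.
etransitivity; first apply: (@integral_is_derive _ (G1 - G2)).
- lra.
- by move=> x; apply: cvgB; [exact: c1|exact: c2].
- move=> x /andP[x1 x2]; apply: is_deriveB; [apply: D1|apply: D2]; apply/andP; lra.
apply: esym; etransitivity; first apply: (@integral_is_derive _ H).
- lra.
- exact: ch.
- by move=> x /andP[x1 x2]; apply: DH; apply/andP; lra.
have DG (G g : R -> R) t : (forall x, - (rho + 1) < x < rho + 1 -> is_derive x (1 : R) G (g x)) ->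
    is_derive t (1 : R) (fun t => G (rho * sin t)) (g (rho * sin t) * (rho * cos t)).
  move=> DG.
  have /DG DGt : - (rho + 1) < rho * sin t < rho + 1.
    by apply: norm_rho_trig => //; rewrite ler_norml sin_geN1 sin_le1.
  have Dc : is_derive t (1 : R) (fun t => rho * sin t) (rho * cos t) by exact: is_deriveZ.
  exact: is_derive1_comp.
have E1 : H (pi / 2) - H 0 = G1 (rho * sin (pi / 2)) - G1 (rho * sin 0).
  have p2 : 0 <= pi / 2 :> R by lra.
  apply: (@eq_increment H (fun t => G1 (rho * sin t)) _ 0 (pi / 2) p2).
  - move=> x /andP[x1 x2]; apply: is_derive_continuous; apply: DH; apply/andP; lra.
  - move=> x _; apply: is_derive_continuous; exact: (DG _ _ _ D1).
  - move=> x /andP[x1 x2]; apply: DH; apply/andP; lra.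
  - move=> x /andP[x1 x2]; have := DG _ _ x D1.
    rewrite half_chord_sin ?ltW// ger0_norm// cos_ge0_pihalf//; apply/andP; lra.
have E2 : H (pi / 2 + pi) - H (pi / 2) = G2 (rho * sin (pi / 2 + pi)) - G2 (rho * sin (pi / 2)).
  have p2 : pi / 2 <= pi / 2 + pi :> R by lra.
  apply: (@eq_increment H (fun t => G2 (rho * sin t)) _ _ _ p2).
  - move=> x /andP[x1 x2]; apply: is_derive_continuous; apply: DH; apply/andP; lra.
  - move=> x _; apply: is_derive_continuous; exact: (DG _ _ _ D2).
  - move=> x /andP[x1 x2]; apply: DH; apply/andP; lra.
  - move=> x /andP[x1 x2]; have := DG _ _ x D2.
    rewrite half_chord_sin ?ltW// ler0_norm ?mulrN ?opprK//.
    have -> : x = (x - pi) + pi by ring.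
    rewrite cosDpi oppr_le0 cos_ge0_pihalf//; apply/andP; lra.
have E3 : H (2 * pi) - H (pi / 2 + pi) = G1 (rho * sin (2 * pi)) - G1 (rho * sin (pi / 2 + pi)).
  have p2 : pi / 2 + pi <= 2 * pi :> R by lra.
  apply: (@eq_increment H (fun t => G1 (rho * sin t)) _ _ _ p2).
  - move=> x /andP[x1 x2]; apply: is_derive_continuous; apply: DH; apply/andP; lra.
  - move=> x _; apply: is_derive_continuous; exact: (DG _ _ _ D1).
  - move=> x /andP[x1 x2]; apply: DH; apply/andP; lra.
  - move=> x /andP[x1 x2]; have := DG _ _ x D1.
    rewrite half_chord_sin ?ltW// ger0_norm//.
    have -> : x = (x - pi - pi) + pi + pi by ring.
    rewrite !cosDpi opprK cos_ge0_pihalf//; apply/andP; lra.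
congr EFin; rewrite !fctE.
have -> : H (2 * pi) - H 0 = (H (2 * pi) - H (pi / 2 + pi)) +
    (H (pi / 2 + pi) - H (pi / 2)) + (H (pi / 2) - H 0) by ring.
rewrite E1 E2 E3 sinDpi sin_pihalf sin0 mulr1 mulrN1 [2 * pi]mulr_natl sin2pi !mulr0; ring.
Qed.

End Integration.

(** * Fubini on disks and Green's formula *)

Section PlanarIntegrals.
Variable R : realType.
Local Notation mu := (@lebesgue_measure R).
Local Open Scope classical_set_scope.
Implicit Types (rho : R) (b B : R * R -> R).

Lemma measurable_closed_disk rho : measurable (closed_disk rho : set (R * R)).
Proof.
have m : measurable_fun setT (fun p : R * R => p.1 ^+ 2 + p.2 ^+ 2).
  by apply: measurable_funD; apply: measurable_funX.
have := m measurableT `]-oo, rho ^+ 2]; rewrite setTI => H.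
rewrite (_ : closed_disk rho = (fun p : R * R => p.1 ^+ 2 + p.2 ^+ 2) @^-1` `]-oo, rho ^+ 2]).
  by apply: H; exact: measurable_itv.
by apply/seteqP; split=> p; rewrite /closed_disk/= in_itv/=.
Qed.

Lemma sqr_le_itv rho (x : R) : 0 <= rho -> x ^+ 2 <= rho ^+ 2 -> - rho <= x <= rho.
Proof. by move=> rho0 H; apply/andP; nra. Qed.

Lemma closed_disk_chord rho x y : - rho <= x <= rho ->
  closed_disk rho (x, y) <-> - half_chord rho x <= y <= half_chord rho x.
Proof.
move=> xr; rewrite -ler_norml -sqrtr_sqr ler_sqrt.
  by rewrite /closed_disk/= lerBrDl.
by rewrite subr_ge0; move: xr => /andP[? ?]; nra.
Qed.

Lemma integral_chord rho x (b1 B1 : R -> R) : 0 < rho -> continuous b1 ->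
  (forall y, is_derive y (1 : R) B1 (b1 y)) ->
  (\int[mu]_y (if (x ^+ 2 + y ^+ 2 <= rho ^+ 2)%R then (b1 y)%:E else 0) =
   (B1 (half_chord rho x) - B1 (- half_chord rho x)%R)%:E)%E.
Proof.
move=> rho0 cb DB; have [xr|xr] := boolP (- rho <= x <= rho).
  rewrite -(@integral_is_derive R b1 B1)//; last first.
    by rewrite (@le_trans _ _ 0) ?sqrtr_ge0// oppr_le0 sqrtr_ge0.
  rewrite [RHS]integral_mkcond; apply: eq_integral => y _; rewrite patchE.
  have H := @closed_disk_chord rho x y xr.
  case: ifPn => D; case: ifPn => // E.
  - by move: E; rewrite notin_setE/= in_itv/= => E; exfalso; apply/E/H.
  - by move: E; rewrite inE/= in_itv/= => /H; rewrite /closed_disk/= (negbTE D).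
(* Off the disk the chord is empty, and both ends of the increment are 0 by the default value of the
   square root. *)
have xr2 : rho ^+ 2 < x ^+ 2.
  rewrite ltNge; apply: contra xr => H.
  exact: sqr_le_itv (ltW rho0) H.
have -> : half_chord rho x = 0 by apply: ler0_sqrtr; rewrite subr_le0 ltW.
rewrite oppr0 subrr integral0_eq// => y _.
case: ifPn => // H; exfalso; move: xr2; rewrite ltNge => /negP; apply.
by apply: le_trans H; rewrite lerDl sqr_ge0.
Qed.

Lemma closed_disk_integrable rho b : 0 < rho -> continuous b ->
  measurable_fun setT b ->
  (mu \x mu)%E.-integrable (closed_disk rho) (EFin \o b).
Proof.
move=> rho0 cb mb; apply: measurable_bounded_integrable.
- exact: measurable_closed_disk.
- apply: (@le_lt_trans _ _ ((mu \x mu)%E (`[-rho, rho]%classic `*` `[-rho, rho]%classic))).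
    apply: le_measure; rewrite ?inE; first exact: measurable_closed_disk.
      by apply: measurableX; exact: measurable_itv.
    move=> [x y]; rewrite /closed_disk/= !in_itv/= => H.
    by split; apply/andP; nra.
  rewrite product_measure1E; [|exact: measurable_itv|exact: measurable_itv].
  rewrite /= !lebesgue_measure_itv/=.
  by case: ifP => _; rewrite -?EFinB -?EFinM ltry.
- exact: measurable_funS mb.
- have [M [Mr HM]] := compact_bounded (continuous_compact (continuous_subspaceT cb) (compact_closed_disk (ltW rho0))).
  by exists M; split => // y My p Kp; apply: HM => //; exists p.
Qed.

Lemma integral_disk_y rho b B : 0 < rho -> continuous b -> measurable_fun setT b ->
  (forall x y, is_derive y (1 : R) (fun y => B (x, y)) (b (x, y))) ->
  (\int[mu \x mu]_(p in closed_disk rho) (b p)%:E =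
   \int[mu]_(x in `[(- rho)%R, rho])
      (B (x, half_chord rho x) - B (x, - half_chord rho x)%R)%:E)%E.
Proof.
move=> rho0 cb mb DB.
have ib := closed_disk_integrable rho0 cb mb.
have [+ _] := @integrable_mkcond _ _ _ (mu \x mu)%E (closed_disk rho)
  (EFin \o b) (measurable_closed_disk rho).
move=> /(_ ib) ib'.
rewrite integral_mkcond -integral12_prod_meas1//.
rewrite [RHS]integral_mkcond; apply: eq_integral => x _.
rewrite /fubini_F.
transitivity (\int[mu]_y (if (x ^+ 2 + y ^+ 2 <= rho ^+ 2)%R then (b (x, y))%:E else 0))%E.
  apply: eq_integral => y _; rewrite patchE/=.
  by case: ifPn => [|]; [rewrite inE => ->|rewrite notin_setE /closed_disk/= => /negP/negbTE ->].
rewrite (@integral_chord _ _ (fun y => b (x, y)) (fun y => B (x, y)))//; last first.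
  by apply: continuous_pair2 => // y; [exact: cvg_cst|exact: cvg_id].
rewrite patchE; case: ifPn => //; rewrite notin_setE/= in_itv/= => xr.
have -> : half_chord rho x = 0; last by rewrite oppr0 subrr.
apply: ler0_sqrtr; rewrite subr_le0; apply/ltW; rewrite ltNge; apply/negP => H; apply: xr.
exact: sqr_le_itv (ltW rho0) H.
Qed.

Lemma integral_disk_x rho b B : 0 < rho -> continuous b -> measurable_fun setT b ->
  (forall x y, is_derive x (1 : R) (fun x => B (x, y)) (b (x, y))) ->
  (\int[mu \x mu]_(p in closed_disk rho) (b p)%:E =
   \int[mu]_(y in `[(- rho)%R, rho])
      (B (half_chord rho y, y) - B (- half_chord rho y, y)%R)%:E)%E.
Proof.
move=> rho0 cb mb DB.
have ib := closed_disk_integrable rho0 cb mb.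
have [+ _] := @integrable_mkcond _ _ _ (mu \x mu)%E (closed_disk rho)
  (EFin \o b) (measurable_closed_disk rho).
move=> /(_ ib) ib'.
rewrite integral_mkcond -integral21_prod_meas1//.
rewrite [RHS]integral_mkcond; apply: eq_integral => y _.
rewrite /fubini_G.
transitivity (\int[mu]_x (if (y ^+ 2 + x ^+ 2 <= rho ^+ 2)%R then (b (x, y))%:E else 0))%E.
  apply: eq_integral => x _; rewrite patchE/= addrC.
  by case: ifPn => [|]; [rewrite inE => ->|rewrite notin_setE /closed_disk/= => /negP/negbTE ->].
rewrite (@integral_chord _ _ (fun x => b (x, y)) (fun x => B (x, y)))//; last first.
  by apply: continuous_pair2 => // x; [exact: cvg_id|exact: cvg_cst].
rewrite patchE; case: ifPn => //; rewrite notin_setE/= in_itv/= => xr.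
have -> : half_chord rho y = 0; last by rewrite oppr0 subrr.
apply: ler0_sqrtr; rewrite subr_le0; apply/ltW; rewrite ltNge; apply/negP => H; apply: xr.
exact: sqr_le_itv (ltW rho0) H.
Qed.

(** The divergence theorem for the field (A, B): (rho cos t, rho sin t) dt is the outward unit
    normal times arc length. Each component is integrated first along its own coordinate. *)
Lemma green_disk rho (A B a b : R * R -> R) : 0 < rho ->
  continuous A -> continuous B -> continuous a -> continuous b ->
  measurable_fun setT a -> measurable_fun setT b ->
  (forall x y, is_derive x (1 : R) (fun x => A (x, y)) (a (x, y))) ->
  (forall x y, is_derive y (1 : R) (fun y => B (x, y)) (b (x, y))) ->
  (\int[mu \x mu]_(p in closed_disk rho) (a p + b p)%:E =
   \int[mu]_(t in `[0%R, (2 * pi)%R])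
     (A (rho * cos t, rho * sin t) * (rho * cos t) +
      B (rho * cos t, rho * sin t) * (rho * sin t))%:E)%E.
Proof.
move=> rho0 cA cB ca cb ma mb DA DB.
have cc := continuous_mulc (a := rho) (@continuous_cos R).
have cs := continuous_mulc (a := rho) (@continuous_sin R).
under eq_integral do rewrite EFinD.
rewrite integralD//=; [|exact: measurable_closed_disk|exact: closed_disk_integrable|exact: closed_disk_integrable].
rewrite (integral_disk_x rho0 ca ma DA) (integral_disk_y rho0 cb mb DB).
rewrite circle_integral_x// circle_integral_y//.
under [RHS]eq_integral do rewrite EFinD.
rewrite integralD//=; apply: continuous_itv_integrable => t; apply: cvgM.
- exact: (continuous_pair2 cA cc cs).
- exact: cc.
- exact: (continuous_pair2 cB cc cs).
- exact: cs.
Qed.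

End PlanarIntegrals.

(** * Area, length and mean values of polynomials on circles *)

Section PolynomialEstimates.
Variable R : realType.
Local Notation mu := (@lebesgue_measure R).
Local Open Scope classical_set_scope.
Local Open Scope complex_scope.
Implicit Types (rho t : R) (S Q H : {poly R[i]}) (z w : R[i]).

Definition circle rho t : R[i] := rho * cos t +i* (rho * sin t).

Lemma normc_nneg z : 0 <= Normc.normc z.
Proof. by case: z => a b; rewrite sqrtr_ge0. Qed.

Lemma le_Re_normc z : `|complex.Re z| <= Normc.normc z.
Proof.
by case: z => a b; rewrite /= -sqrtr_sqr ler_sqrt ?lerDl ?sqr_ge0// addr_ge0 ?sqr_ge0.
Qed.

Lemma primitive_poly S : exists H, deriv H = S.
Proof.
exists (\poly_(i < (size S).+1) (S`_i.-1 / i%:R)).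
apply/polyP => i; rewrite coef_deriv coef_poly ltnS /=.
case: ltnP => [iS|Si]; last by rewrite mul0rn nth_default.
by rewrite -[_ *+ _]mulr_natr divfK// pnatr_eq0.
Qed.

Lemma is_derive_circle Q rho t :
  is_derive t (1 : R) (fun t => complex.Re Q.[circle rho t])
    (- rho * (complex.Re (deriv Q).[circle rho t] * sin t + complex.Im (deriv Q).[circle rho t] * cos t)) /\
  is_derive t (1 : R) (fun t => complex.Im Q.[circle rho t])
    (rho * (complex.Re (deriv Q).[circle rho t] * cos t - complex.Im (deriv Q).[circle rho t] * sin t)).
Proof.
have dx : is_derive t (1 : R) (fun t => rho * cos t) (rho * - sin t) by exact: is_deriveZ.
have dy : is_derive t (1 : R) (fun t => rho * sin t) (rho * cos t) by exact: is_deriveZ.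
have := is_derive_horner Q dx dy; rewrite -/(circle rho t) ReM ImM /=.
move: (_.[_]) => q [D1 D2]; split.
  by rewrite (_ : - rho * _ = complex.Re q * (rho * - sin t) - complex.Im q * (rho * cos t))//; ring.
by rewrite (_ : rho * _ = complex.Re q * (rho * cos t) + complex.Im q * (rho * - sin t))//; ring.
Qed.

Lemma continuous_circle Q rho :
  continuous (fun t => complex.Re Q.[circle rho t]) /\
  continuous (fun t => complex.Im Q.[circle rho t]).
Proof.
by split=> t; [have [D _] := is_derive_circle Q rho t|have [_ D] := is_derive_circle Q rho t];
  apply: is_derive_continuous D.
Qed.

Lemma continuous_normc_circle Q rho :
  continuous (fun t => Normc.normc Q.[circle rho t]).
Proof.
have [cr ci] := continuous_circle Q rho.
rewrite (_ : (fun t => _) = @Num.sqrt R \o (fun t =>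
  complex.Re Q.[circle rho t] ^+ 2 + complex.Im Q.[circle rho t] ^+ 2)); last first.
  by apply/funext => t /=; case: (_.[_]).
move=> t; apply: continuous_comp; last exact: sqrt_continuous.
by apply: cvgD; apply: cvgM; [exact: cr|exact: cr|exact: ci|exact: ci].
Qed.

Lemma measurable_horner Q :
  measurable_fun setT (fun p : R * R => complex.Re Q.[toC p]) /\
  measurable_fun setT (fun p : R * R => complex.Im Q.[toC p]).
Proof.
elim/poly_ind: Q => [|q c [Cr Ci]].
  by split; under eq_fun do rewrite horner0; exact: measurable_cst.
split.
  have -> : (fun p : R * R => complex.Re (q * 'X + c%:P).[toC p]) =
     (fun p => complex.Re q.[toC p] * p.1 - complex.Im q.[toC p] * p.2 + complex.Re c).
    apply/funext => -[x y]; rewrite !hornerE /toC/=.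
    by case: c (q.[_]) => [c c'] [a b] /=.
  by apply: measurable_funD => //; apply: measurable_funB; apply: measurable_funM.
have -> : (fun p : R * R => complex.Im (q * 'X + c%:P).[toC p]) =
   (fun p => complex.Re q.[toC p] * p.2 + complex.Im q.[toC p] * p.1 + complex.Im c).
  apply/funext => -[x y]; rewrite !hornerE /toC/=.
  by case: c (q.[_]) => [c c'] [a b] /=.
by apply: measurable_funD => //; apply: measurable_funD; apply: measurable_funM.
Qed.

Lemma is_derive_horner_x Q (x y : R) :
  is_derive x (1 : R) (fun x => complex.Re Q.[toC (x, y)]) (complex.Re (deriv Q).[toC (x, y)]) /\
  is_derive x (1 : R) (fun x => complex.Im Q.[toC (x, y)]) (complex.Im (deriv Q).[toC (x, y)]).
Proof.
have := is_derive_horner Q (is_derive_id x (1 : R)) (is_derive_cst y x (1 : R)).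
by rewrite -[_ +i* 0]/(1%:C) mulr1.
Qed.

Lemma is_derive_horner_y Q (x y : R) :
  is_derive y (1 : R) (fun y => complex.Re Q.[toC (x, y)]) (- complex.Im (deriv Q).[toC (x, y)]) /\
  is_derive y (1 : R) (fun y => complex.Im Q.[toC (x, y)]) (complex.Re (deriv Q).[toC (x, y)]).
Proof.
have := is_derive_horner Q (is_derive_cst x y (1 : R)) (is_derive_id y (1 : R)).
by rewrite ReM ImM /= !(mulr0, mulr1, sub0r, addr0).
Qed.

(* |H'|^2 = d/dx (Re H Re H') - d/dy (Re H Im H') *)
Lemma area_primitive rho H : 0 < rho -> let S := deriv H in
  (\int[mu \x mu]_(p in closed_disk rho) (Normc.normc S.[toC p] ^+ 2)%:E =
   \int[mu]_(t in `[0%R, (2 * pi)%R])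
     (complex.Re H.[circle rho t] * (rho *
      (complex.Re S.[circle rho t] * cos t - complex.Im S.[circle rho t] * sin t)))%:E)%E.
Proof.
move=> rho0 S; set S' := deriv S.
pose rP q := fun p : R * R => complex.Re q.[toC p].
pose iP q := fun p : R * R => complex.Im q.[toC p].
pose A p : R := rP H p * rP S p.
pose B p : R := - (rP H p * iP S p).
(* By the Cauchy-Riemann equations [a] is the x-derivative of [A] and [b] the y-derivative of [B];
   the products of Re H with the second derivative cancel in a + b. *)
pose a p : R := rP H p * rP S' p + rP S p * rP S p.
pose b p : R := - (rP H p * rP S' p - iP S p * iP S p).
have cR q : continuous (rP q) by exact: (continuous_horner q).1.
have cI q : continuous (iP q) by exact: (continuous_horner q).2.
have mR q : measurable_fun setT (rP q) by exact: (measurable_horner q).1.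
have mI q : measurable_fun setT (iP q) by exact: (measurable_horner q).2.
under eq_integral => p _.
  rewrite (_ : Normc.normc _ ^+ 2 = a p + b p); last first.
    by rewrite sqr_normc /a /b /rP /iP; ring.
  over.
etransitivity; first apply: (@green_disk _ rho A B a b) => //.
- by rewrite /A => p; apply: cvgM; exact: cR.
- by rewrite /B => p; apply: cvgN; apply: cvgM; [exact: cR|exact: cI].
- by rewrite /a => p; apply: cvgD; apply: cvgM; exact: cR.
- by rewrite /b => p; apply: cvgN; apply: cvgB; apply: cvgM; [exact: cR|exact: cR|exact: cI|exact: cI].
- by rewrite /a; apply: measurable_funD; apply: measurable_funM.
- by rewrite /b; apply: measurableT_comp => //; apply: measurable_funB; apply: measurable_funM.
- move=> x y; have [D1 _] := is_derive_horner_x H x y; have [D2 _] := is_derive_horner_x S x y.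
  apply: (is_derive_eq (is_deriveM D1 D2)).
  by rewrite /a /rP /GRing.scale/=; ring.
- move=> x y; have [D1 _] := is_derive_horner_y H x y; have [_ D2] := is_derive_horner_y S x y.
  apply: (is_derive_eq (is_deriveN (is_deriveM D1 D2))).
  by rewrite /b /rP /iP /GRing.scale/=; ring.
apply: eq_integral => t _; congr EFin.
by rewrite /A /B /rP /iP /toC/= -/(circle rho t); ring.
Qed.

Lemma continuous_trig_comb rho Q :
  continuous (fun t => rho * (complex.Re Q.[circle rho t] * cos t - complex.Im Q.[circle rho t] * sin t)) /\
  continuous (fun t => - rho * (complex.Re Q.[circle rho t] * sin t + complex.Im Q.[circle rho t] * cos t)).
Proof.
have [cr ci] := continuous_circle Q rho.
have cs := @continuous_sin R; have cc := @continuous_cos R.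
split; apply: continuous_mulc => t.
  by apply: cvgB; apply: cvgM; [exact: cr|exact: cc|exact: ci|exact: cs].
by apply: cvgD; apply: cvgM; [exact: cr|exact: cs|exact: ci|exact: cc].
Qed.

(** Up to sign, the two combinations are rho times the real and imaginary parts of z e^(it), a
    number of modulus |z|. They are the speeds of Im H and Re H along the circle when z is the
    derivative of H. *)
Lemma norm_trig_comb rho z t : 0 <= rho ->
  `|rho * (complex.Re z * cos t - complex.Im z * sin t)| <= rho * Normc.normc z /\
  `|- rho * (complex.Re z * sin t + complex.Im z * cos t)| <= rho * Normc.normc z.
Proof.
move=> rho0; case: z => a b /=; rewrite !normrM normrN (ger0_norm rho0).
split; apply: ler_wpM2l => //; rewrite -sqrtr_sqr ler_sqrt ?addr_ge0 ?sqr_ge0//.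
  rewrite -[leRHS]mulr1 -(cos2Dsin2 t) -subr_ge0.
  rewrite (_ : _ - _ = (a * sin t + b * cos t) ^+ 2) ?sqr_ge0//; ring.
rewrite -[leRHS]mulr1 -(cos2Dsin2 t) -subr_ge0.
rewrite (_ : _ - _ = (a * cos t - b * sin t) ^+ 2) ?sqr_ge0//; ring.
Qed.

(** In the boundary integral of (Re H) d(Im H), each factor is bounded separately: Re H starts from
    0 and so never exceeds the length travelled, and d(Im H) is at most the length element. The
    sharp isoperimetric constant would be 1 / (4 pi) instead of 1. *)
Lemma area_le_sqr_length rho S : 0 < rho ->
  (\int[mu \x mu]_(p in closed_disk rho) (Normc.normc S.[toC p] ^+ 2)%:E <=
   (\int[mu]_(t in `[0%R, (2 * pi)%R]) (rho * Normc.normc S.[circle rho t])%:E) *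
   (\int[mu]_(t in `[0%R, (2 * pi)%R]) (rho * Normc.normc S.[circle rho t])%:E))%E.
Proof.
move=> rho0; have [H0 HS] := primitive_poly S.
pose H := H0 - (complex.Re H0.[circle rho 0])%:C%:P.
have {}HS : deriv H = S by rewrite derivB derivC subr0.
have H00 : complex.Re H.[circle rho 0] = 0.
  by rewrite hornerD hornerN hornerC raddfB/= subrr.
have pi0 := pi_gt0 R.
pose q t := rho * Normc.normc S.[circle rho t].
have cq : continuous q by apply: continuous_mulc; exact: continuous_normc_circle.
have q0 t : 0 <= q t by apply: mulr_ge0; [exact: ltW|exact: normc_nneg].
have iq a b : mu.-integrable `[a, b] (EFin \o q) by exact: continuous_itv_integrable.
have Lfin : (\int[mu]_(t in `[0%R, (2 * pi)%R]) (q t)%:E \is a fin_num)%E.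
  by apply: integrable_fin_num => //; exact: iq.
rewrite -/q; set L := (\int[mu]_(t in _) (q t)%:E)%E in Lfin *.
have HL t : 0 <= t <= 2 * pi -> (`|complex.Re H.[circle rho t]|%:E <= L)%E.
  move=> /andP[t0 t2].
  have [c1 c2] := continuous_trig_comb rho S.
  have E := @integral_is_derive R _ (fun t => complex.Re H.[circle rho t]) 0 t t0 c2.
  rewrite H00 subr0 in E.
  have /E {}E : forall x : R, 0 <= x <= t -> is_derive x (1 : R)
      (fun t => complex.Re H.[circle rho t]) (- rho *
      (complex.Re S.[circle rho x] * sin x + complex.Im S.[circle rho x] * cos x)).
    by move=> x _; have [D _] := is_derive_circle H rho x; rewrite HS in D.
  rewrite -abse_EFin -E.
  apply: (le_trans (le_abse_integral _ _ _)) => //.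
    exact: measurable_int (continuous_itv_integrable _ _ c2).
  apply: (@le_trans _ _ (\int[mu]_(t in `[0%R, t]) (q t)%:E)%E).
    apply: ge0_le_integral => //.
    - apply: measurableT_comp => //.
      exact: measurable_int (continuous_itv_integrable _ _ c2).
    - exact: measurable_int (iq _ _).
    - by move=> x _; rewrite lee_fin; exact: (norm_trig_comb _ _ (ltW rho0)).2.
  apply: ge0_subset_integral => //.
  - exact: measurable_int (iq _ _).
  - by move=> x _; rewrite lee_fin.
  - by move=> x /=; rewrite !in_itv/= => /andP[-> xt]; exact: le_trans xt t2.
have /= AP := area_primitive H rho0.
rewrite HS in AP; rewrite AP.
rewrite -[X in (X * _)%E](fineK Lfin) /L.
rewrite -integralZl//.
have [c1 c2] := continuous_trig_comb rho S.
apply: le_integral => //.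
- apply: (@continuous_itv_integrable _ (fun t => complex.Re H.[circle rho t] * _)) => t.
  by apply: cvgM; [exact: (continuous_circle H rho).1|exact: c1].
- apply: (@continuous_itv_integrable _ (fun t => fine L * q t)).
  by apply: continuous_mulc.
move=> t; rewrite inE/= in_itv/= => tt; rewrite -EFinM lee_fin.
apply: (le_trans (ler_norm _)); rewrite normrM; apply: ler_pM => //.
  by rewrite -lee_fin fineK// HL.
exact: (norm_trig_comb _ _ (ltW rho0)).1.
Qed.

(** The mean value property without a Cauchy integral: if Q = q X + c and G is a primitive of q,
    then Re (z q(z)) is the derivative of Im G in the angle, and it integrates to 0 by periodicity.
    The induction serves only to split off c. *)
Lemma integral_Re_circle rho Q :
  (\int[mu]_(t in `[0%R, (2 * pi)%R]) (complex.Re Q.[circle rho t])%:E =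
   (2 * pi * complex.Re Q.[0])%:E)%E.
Proof.
have pi0 := pi_gt0 R; have pi2 : 0 <= 2 * pi :> R by lra.
elim/poly_ind: Q => [|q c _].
  by under eq_integral do rewrite horner0; rewrite integral0 horner0 mulr0.
have [G GE] := primitive_poly q.
pose F t := complex.Im G.[circle rho t] + complex.Re c * t.
etransitivity; first apply: (@integral_is_derive _ _ F) => //.
- exact: (continuous_circle _ _).1.
- move=> t _; have [_ D] := is_derive_circle G rho t.
  have Dc : is_derive t (1 : R) (fun t => complex.Re c * t) (complex.Re c * 1) by exact: is_deriveZ.
  apply: (is_derive_eq (is_deriveD D Dc)).
  rewrite GE !hornerE raddfD/= ReM /=; ring.
rewrite /F /circle [2 * pi]mulr_natl cos2pi sin2pi cos0 sin0 !hornerE /=.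
by congr EFin; ring.
Qed.

Lemma integral_sqr_normc_circle rho Q : complex.Im Q.[0] = 0 ->
  (\int[mu]_(t in `[0%R, (2 * pi)%R]) (Normc.normc Q.[circle rho t] ^+ 2)%:E <=
   2%:E * \int[mu]_(t in `[0%R, (2 * pi)%R]) (complex.Re Q.[circle rho t] ^+ 2)%:E)%E.
Proof.
move=> Q0.
have [cr ci] := continuous_circle Q rho.
have ir : mu.-integrable `[0, 2 * pi] (EFin \o (fun t => 2 * complex.Re Q.[circle rho t] ^+ 2)).
  apply: continuous_itv_integrable => t; apply: cvgM; first exact: cvg_cst.
  by apply: cvgM; exact: cr.
have i2 : mu.-integrable `[0, 2 * pi] (EFin \o (fun t => complex.Re (Q ^+ 2).[circle rho t])).
  by apply: continuous_itv_integrable; exact: (continuous_circle _ _).1.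
rewrite -integralZl//; last first.
  by apply: (@continuous_itv_integrable _ (fun t => complex.Re Q.[circle rho t] ^+ 2)) => t; apply: cvgM; exact: cr.
(* The pointwise identity |Q|^2 = 2 (Re Q)^2 - Re (Q^2). *)
rewrite [leLHS](_ : _ = \int[mu]_(t in `[0%R, (2 * pi)%R])
   ((2 * complex.Re Q.[circle rho t] ^+ 2)%:E - (complex.Re (Q ^+ 2).[circle rho t])%:E))%E; last first.
  apply: eq_integral => t _; rewrite -EFinB; congr EFin.
  rewrite sqr_normc expr2 hornerM ReM; ring.
rewrite integralB//= integral_Re_circle.
under [leRHS]eq_integral do rewrite -EFinM.
rewrite leeBlDr// leeDl// lee_fin expr2 hornerM ReM Q0 mulr0 subr0 -expr2.
by rewrite mulr_ge0 ?sqr_ge0// mulr_ge0// pi_ge0.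
Qed.

End PolynomialEstimates.

(** * Integrals over increasing unions *)

Section Exhaustion.
Local Open Scope classical_set_scope.
Local Open Scope ereal_scope.

(** The integral of a nonnegative function is the supremum over the simple functions below it, and
    monotone convergence along K is applied to these, whose measurability is built in. *)
Lemma ge0_integral_exhaustion (d : measure_display) (T : measurableType d)
    (R : realType) (nu : {measure set T -> \bar R}) (f : T -> \bar R)
    (D : set T) (K : (set T)^nat) (M : \bar R) :
  measurable D -> (forall x, D x -> 0 <= f x) ->
  nondecreasing_seq K -> (forall n, measurable (K n)) -> D = \bigcup_n K n ->
  (forall n (h : {nnsfun T >-> R}), (forall x, K n x -> (h x)%:E <= f x) ->
     \int[nu]_(x in K n) (h x)%:E <= M) ->
  \int[nu]_(x in D) f x <= M.
Proof.
move=> mD f0 ndK mK DK HM; rewrite ge0_integralE//.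
apply: ge_ereal_sup => _ [h /= hf <-].
rewrite -integralT_nnsfun.
(* Outside D the restriction of f is 0, which forces h to vanish there. *)
have -> : \int[nu]_x (h x)%:E = \int[nu]_(x in D) (h x)%:E.
  rewrite [RHS]integral_mkcond; apply: eq_integral => x _; rewrite patchE.
  case: ifPn => // Dx; have := hf x; rewrite patchE (negbTE Dx) lee_fin => hx.
  by congr EFin; apply/eqP; rewrite eq_le hx fun_ge0.
have cvgh := @ge0_nondecreasing_set_cvg_integral _ _ _ K (EFin \o h) nu ndK mK.
rewrite DK; have {}cvgh : \int[nu]_(x in K i) (h x)%:E @[i --> \oo] -->
    \int[nu]_(x in \bigcup_i K i) (h x)%:E.
  apply: cvgh => [i|i x _]; last by rewrite lee_fin fun_ge0.
  by apply/measurable_EFinP; exact: measurable_funTS.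
rewrite -(cvg_lim _ cvgh)//; apply: lime_le; first by apply/cvg_ex; exists (\int[nu]_(x in \bigcup_i K i) (h x)%:E).
near=> n; apply: HM => x Knx.
have := hf x; rewrite patchE ifT// inE DK; by exists n.
Unshelve. all: by end_near. Qed.

End Exhaustion.

(** * Uniform continuity of functions on the circle *)

Section CircleUniformContinuity.
Variable R : realType.
Local Open Scope classical_set_scope.
Variable phi : R -> R.
Hypothesis cphi : continuous phi.
Hypothesis circ : forall s t, cos s = cos t -> sin s = sin t -> phi s = phi t.

Let reduce (t : R) : exists2 t', - pi <= t' <= pi & cos t' = cos t /\ sin t' = sin t.
Proof.
have E : (cos t, sin t).1 ^+ 2 + (cos t, sin t).2 ^+ 2 = 1 ^+ 2.
  by rewrite /= cos2Dsin2 expr1n.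
have [t' t'pi] := polar_angle ltr01 E.
by rewrite !mul1r => -[-> ->]; exists t'.
Qed.

Lemma circle_bounded : exists B, forall t, `|phi t| <= B.
Proof.
have pi0 := pi_gt0 R; have npi : - pi <= pi :> R by lra.
have cn : {within `[(- pi), pi]%classic, continuous (fun t => `|phi t|)}.
  by apply: continuous_subspaceT => t; apply: cvg_norm; exact: cphi.
have [c _ cmax] := EVT_max npi cn.
exists `|phi c| => t; have [t' tpi [ct st]] := reduce t.
by rewrite -(circ ct st); apply: cmax; rewrite in_itv.
Qed.

(* The minimum of [1 - cos (t - s)] over the compact set of pairs of angles with
   [e <= |phi t - phi s|] is positive. *)
Lemma circle_uniform_continuity (e : R) : 0 < e -> exists2 eta : R, 0 < eta &
  forall s t, 1 - cos (t - s) < eta -> `|phi t - phi s| <= e.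
Proof.
move=> e0; have pi0 := pi_gt0 R.
pose I := `[(- pi : R), pi]%classic.
pose C := (I `*` I) `&` [set p : R * R | e <= `|phi p.2 - phi p.1|].
have cd : continuous (fun p : R * R => `|phi p.2 - phi p.1|).
  move=> p; apply: cvg_norm; apply: cvgB.
    by apply: (@cvg_comp _ _ _ snd phi _ (nbhs p.2)); [exact: cvg_snd|exact: cphi].
  by apply: (@cvg_comp _ _ _ fst phi _ (nbhs p.1)); [exact: cvg_fst|exact: cphi].
have cC : compact C.
  apply: compact_closedI; first by apply: compact_setX; exact: segment_compact.
  by apply: (@closed_comp _ _ (fun p : R * R => `|phi p.2 - phi p.1|) [set x | e <= x]);
    [move=> p _; exact: cd|exact: closed_ge].
pose g (p : R * R) := 1 - cos (p.2 - p.1).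
have cg : continuous g.
  move=> p; rewrite /g; apply: cvgB; first exact: cvg_cst.
  apply: (@cvg_comp _ _ _ (fun p : R * R => p.2 - p.1) cos _ (nbhs (p.2 - p.1))).
    by apply: cvgB; [exact: cvg_snd|exact: cvg_fst].
  exact: continuous_cos.
have main eta : (forall p, C p -> eta <= g p) ->
    forall s t, 1 - cos (t - s) < eta -> `|phi t - phi s| <= e.
  move=> H s t; have [s' spi [cs ss]] := reduce s; have [t' tpi [ct st]] := reduce t.
  rewrite -(circ cs ss) -(circ ct st) cosB -ct -cs -ss -st -cosB => lt_eta.
  rewrite leNgt; apply/negP => /ltW le_e.
  have : eta <= g (s', t') by apply: H; split => //=; rewrite /I/= !in_itv/=.
  by rewrite leNgt /g/= lt_eta.
have [[p0 Cp0]|nC] := pselect (C !=set0); last first.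
  by exists 1 => //; apply: main => p Cp; exfalso; apply: nC; exists p.
have [p] := @compact_EVT_min _ R g C (ex_intro _ p0 Cp0) cC (continuous_subspaceT cg).
rewrite inE => Cp pmin; exists (g p); last first.
  by apply: main => q Cq; apply: pmin; rewrite inE.
have g0 : 0 <= g p by rewrite subr_ge0 cos_le1.
rewrite lt_neqAle g0 andbT; apply/eqP => /esym gp.
(* The squared chord is 2 (1 - cos). If g vanished at p, both angles would give the same point of
   the circle, where phi takes one value, against the definition of C. *)
have : (cos p.2 - cos p.1) ^+ 2 + (sin p.2 - sin p.1) ^+ 2 = 2 * g p.
  rewrite /g cosB; have := cos2Dsin2 p.1; have := cos2Dsin2 p.2.
  lra.
rewrite gp mulr0 => /eqP; rewrite paddr_eq0 ?sqr_ge0// !sqrf_eq0 !subr_eq0 => /andP[/eqP c /eqP s].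
have [_ /=] := Cp; rewrite (circ c s) subrr normr0 => e0'.
by move: e0; rewrite ltNge e0'.
Qed.

End CircleUniformContinuity.

Lemma continuous_itv_measurable (R : realType) (g : R -> R) (a b : R) :
  continuous g -> measurable_fun `[a, b]%classic (EFin \o g).
Proof. by move=> cg; exact: measurable_int (continuous_itv_integrable a b cg). Qed.

(** The increase of the square is 8 Y d + 4 d^2, at most d (8 Y + 4) for d <= 1; the constant 16
    makes the inequality strict. *)
Lemma sqr_perturbation_lt (R : realType) (Y c d : R) : 0 <= Y -> 0 < d -> d <= 1 ->
  d * (16 * (Y + 1)) <= c -> (2 * (Y + d)) ^+ 2 < c + (2 * Y) ^+ 2.
Proof. by move=> Y0 d0 d1 dc; nra. Qed.

(** * The estimate on a disk of radius rho < 1 *)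

Section DiskEstimate.
Variable R : realType.
Local Notation mu := (@lebesgue_measure R).
Local Open Scope classical_set_scope.
Local Open Scope complex_scope.
Variable f : R[i] -> R[i].
Hypothesis hf : harmonic_disk f.

Lemma continuous_normc_harmonic_circle rho : 0 < rho < 1 ->
  continuous (fun t => Normc.normc (f (circle rho t)) ^+ 2).
Proof.
move=> /andP[rho0 rho1]; rewrite (_ : (fun t => _) = (fun t =>
    complex.Re (f (circle rho t)) ^+ 2 + complex.Im (f (circle rho t)) ^+ 2)); last first.
  by apply/funext => t; rewrite sqr_normc.
have [[Cu _] [Cv _]] := hf.
have D t : (@toC R @^-1` (@unit_disk R)) (rho * cos t, rho * sin t).
  apply/mem_unit_disk; rewrite /= !exprMn -mulrDr cos2Dsin2 mulr1.
  by rewrite expr_lt1// ltW.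
have cp : continuous (fun t : R => (rho * cos t, rho * sin t)).
  move=> t.
  exact: (cvg_pair (@continuous_mulc R rho _ (@continuous_cos R) t) (@continuous_mulc R rho _ (@continuous_sin R) t)).
have cu t : {for t, continuous (fun t => complex.Re (f (circle rho t)))}.
  exact: (@cvg_comp _ _ _ _ (fun p => complex.Re (f (toC p))) _ _ _ (cp t) (Cu.1 _ (D t))).
have cv t : {for t, continuous (fun t => complex.Im (f (circle rho t)))}.
  exact: (@cvg_comp _ _ _ _ (fun p => complex.Im (f (toC p))) _ _ _ (cp t) (Cv.1 _ (D t))).
by move=> t; apply: cvgD; apply: cvgM; [exact: cu|exact: cu|exact: cv|exact: cv].
Qed.

Lemma polynomial_majorant rho (eps : R) : 0 < rho < 1 -> 0 < eps ->
  exists Q : {poly R[i]}, [/\ complex.Im Q.[0] = 0,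
    forall p, closed_disk rho p ->
      Normc.normc (f (toC p)) ^+ 2 <= complex.Re Q.[toC p] &
    forall t, 0 <= complex.Re Q.[circle rho t] <=
      Normc.normc (f (circle rho t)) ^+ 2 + eps].
Proof.
move=> rho01 eps0; have /andP[rho0 rho1] := rho01.
have cphi := continuous_normc_harmonic_circle rho01.
set phi := (fun t => _) in cphi.
have circ s t : cos s = cos t -> sin s = sin t -> phi s = phi t.
  by rewrite /phi /circle => -> ->.
have [B HB] := circle_bounded cphi circ.
have eps2 : 0 < eps / 2 by rewrite divr_gt0.
have [Q0 Q00 HQ0] := trigonometric_approximation rho0 eps2 HB (circle_uniform_continuity cphi circ).
have HQ t : phi t <= complex.Re Q0.[circle rho t] + eps / 2 /\
    complex.Re Q0.[circle rho t] + eps / 2 <= phi t + eps.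
  have := HQ0 t; rewrite -/(circle rho t) ler_norml => /andP[]; split; lra.
(* Raising an approximation of precision eps / 2 by eps / 2 puts Re Q between |f|^2 and |f|^2 + eps
   on the circle. In particular Re Q is nonnegative there, which later allows squaring the upper
   bound. *)
pose Q := Q0 + (eps / 2)%:C%:P.
have QE z : complex.Re Q.[z] = complex.Re Q0.[z] + eps / 2.
  by rewrite hornerD hornerC raddfD.
exists Q; split.
- by rewrite hornerD hornerC raddfD/= Q00 addr0.
- apply: sqr_normc_majorant => // t; rewrite QE; exact: (HQ t).1.
- move=> t; rewrite QE (HQ t).2 andbT (le_trans _ (HQ t).1)// /phi sqr_ge0//.
Qed.

Lemma disk_estimate rho (Y : R)
    (h : {nnsfun (measurableTypeR R * measurableTypeR R)%type >-> R}) : 0 < rho < 1 ->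
  (\int[mu]_(t in `[0%R, (2 * pi)%R]) (Normc.normc (f (circle rho t)) ^+ 4)%:E <= Y%:E)%E ->
  (forall p, closed_disk rho p -> h p <= Normc.normc (f (toC p)) ^+ 8) ->
  (\int[mu \x mu]_(p in closed_disk rho) (h p)%:E <= ((2 * Y) ^+ 2)%:E)%E.
Proof.
move=> rho01 HY hf8; have /andP[rho0 rho1] := rho01.
have pi0 := pi_gt0 R; have pi4 : pi < 4 :> R by have := pihalf_lt2 R; lra.
have cphi := continuous_normc_harmonic_circle rho01.
set phi := (fun t => _) in cphi.
have circ s t : cos s = cos t -> sin s = sin t -> phi s = phi t.
  by rewrite /phi /circle => -> ->.
have [B HB] := circle_bounded cphi circ.
have B0 : 0 <= B by rewrite (le_trans _ (HB 0)).
have Y0 : 0 <= Y.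
  rewrite -lee_fin (le_trans _ HY)//; apply: integral_ge0 => t _.
  by rewrite lee_fin exprn_ge0// normc_nneg.
have step del : 0 < del -> (\int[mu \x mu]_(p in closed_disk rho) (h p)%:E <=
    ((2 * (Y + del)) ^+ 2)%:E)%E.
  move=> del0.
  (* With eps <= 1 and |f|^2 <= B on the circle, (|f|^2 + eps)^2 exceeds |f|^4 by at most eps (2 B +
     1) <= del / 8, and the interval of integration has length 2 pi < 8. *)
  pose eps := Num.min 1 (del / (8 * (2 * B + 1))).
  have B1 : 0 < 2 * B + 1 by lra.
  have eps0 : 0 < eps by rewrite lt_min ltr01 divr_gt0// mulr_gt0.
  have [epsle1 epsdel] : eps <= 1 /\ eps * (8 * (2 * B + 1)) <= del.
    by rewrite -ler_pdivlMr ?mulr_gt0//; split; rewrite /eps ge_min lexx ?orbT.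
  have [Q [Q0 Qmaj Qcirc]] := polynomial_majorant rho01 eps0.
  have cQ := (continuous_circle Q rho).1.
  have I1 : (\int[mu]_(t in `[0%R, (2 * pi)%R]) (complex.Re Q.[circle rho t] ^+ 2)%:E <= (Y + del)%:E)%E.
    apply: (@le_trans _ _ (\int[mu]_(t in `[0%R, (2 * pi)%R]) ((Normc.normc (f (circle rho t)) ^+ 4)%:E + (del / 8)%:E))%E).
      apply: ge0_le_integral => //.
      - by move=> t _; rewrite lee_fin sqr_ge0.
      - apply: (@continuous_itv_measurable R (fun t => complex.Re Q.[circle rho t] ^+ 2)) => t.
        by apply: cvgM; exact: cQ.
      - rewrite (_ : (fun t => _) = EFin \o (fun t => phi t * phi t + del / 8)); last first.
          by apply/funext => t /=; rewrite -EFinD /phi -exprD.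
        apply: continuous_itv_measurable => t.
        by apply: cvgD; [apply: cvgM; exact: cphi|exact: cvg_cst].
      - move=> t _; rewrite -EFinD lee_fin.
        have := Qcirc t; rewrite -/(phi t) => /andP[q0 q1].
        have -> : Normc.normc (f (circle rho t)) ^+ 4 = phi t ^+ 2 by rewrite /phi -exprM.
        have := HB t; rewrite ler_norml => /andP[_ pB].
        have p0 : 0 <= phi t by rewrite sqr_ge0.
        apply: (@le_trans _ _ ((phi t + eps) ^+ 2)); first by rewrite ler_sqr ?nnegrE// addr_ge0// ltW.
        nra.
    rewrite ge0_integralD//=; last 3 first.
    - by move=> t _; rewrite lee_fin exprn_ge0// normc_nneg.
    - rewrite (_ : (fun t => _) = EFin \o (fun t => phi t * phi t)); last first.
        by apply/funext => t /=; rewrite /phi -exprD.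
      apply: continuous_itv_measurable => t.
      by apply: cvgM; exact: cphi.
    - by move=> t _; rewrite lee_fin divr_ge0// ltW.
    rewrite EFinD leeD// integral_cst//= lebesgue_measure_itv/= lte_fin mulr_gt0// oppr0 adde0 -EFinM lee_fin.
    nra.
  have I2 : (\int[mu]_(t in `[0%R, (2 * pi)%R]) (rho * Normc.normc (Q ^+ 2).[circle rho t])%:E <= (2 * (Y + del))%:E)%E.
    apply: (@le_trans _ _ (\int[mu]_(t in `[0%R, (2 * pi)%R]) (Normc.normc Q.[circle rho t] ^+ 2)%:E)%E).
      apply: ge0_le_integral => //.
      - by move=> t _; rewrite lee_fin mulr_ge0 ?normc_nneg// ltW.
      - apply: continuous_itv_measurable.
        by apply: continuous_mulc; exact: continuous_normc_circle.
      - apply: (@continuous_itv_measurable R (fun t => Normc.normc Q.[circle rho t] ^+ 2)) => t.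
        by apply: cvgM; exact: continuous_normc_circle.
      - move=> t _; rewrite lee_fin expr2 hornerM Normc.normcM -expr2.
        by rewrite ler_piMl ?sqr_ge0// ltW.
    apply: (le_trans (integral_sqr_normc_circle rho Q0)).
    by rewrite EFinM; apply: lee_wpmul2l => //; rewrite lee_fin.
  apply: (@le_trans _ _ (\int[mu \x mu]_(p in closed_disk rho) (Normc.normc (Q ^+ 2).[toC p] ^+ 2)%:E)%E).
    apply: ge0_le_integral => //.
    - exact: measurable_closed_disk.
    - by move=> p _; rewrite lee_fin fun_ge0.
    - apply/measurable_EFinP; apply: measurable_funTS.
      exact: measurable_funPT.
    - apply/measurable_EFinP; apply: measurable_funTS.
      rewrite (_ : (fun p => _) = (fun p : R * R => complex.Re (Q ^+ 2).[toC p] ^+ 2 + complex.Im (Q ^+ 2).[toC p] ^+ 2)); last first.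
        by apply/funext => p; rewrite sqr_normc.
      have [mr mi] := measurable_horner (Q ^+ 2).
      by apply: measurable_funD; apply: measurable_funX; [exact: mr|exact: mi].
    - move=> p Kp; rewrite lee_fin (le_trans (hf8 p Kp))//.
      rewrite [Q ^+ 2]expr2 hornerM Normc.normcM -expr2 -exprM (_ : 8 = 2 * 4)%N// exprM.
      apply: lerXn2r; rewrite ?nnegrE ?sqr_ge0 ?normc_nneg//.
      apply: (le_trans (Qmaj p Kp)); apply: (le_trans (ler_norm _)); exact: le_Re_normc.
  apply: (le_trans (area_le_sqr_length _ rho0)).
  rewrite expr2 EFinM; apply: lee_pmul => //; apply: integral_ge0 => t _;
    by rewrite lee_fin mulr_ge0 ?normc_nneg// ltW.
(* The limit del -> 0, by contradiction: the case del = 1 shows that the integral is finite, and an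
   excess c over (2 Y)^2 is refuted by a del small compared with c. *)
have [I|I] := leP (\int[mu \x mu]_(p in closed_disk rho) (h p)%:E)%E ((2 * Y) ^+ 2)%:E => //.
have Ifin : (\int[mu \x mu]_(p in closed_disk rho) (h p)%:E)%E \is a fin_num.
  rewrite ge0_fin_numE; first by apply: le_lt_trans (step 1 ltr01) _; rewrite ltry.
  by apply: integral_ge0 => p _; rewrite lee_fin fun_ge0.
move: I step; rewrite -(fineK Ifin); set J := fine _; rewrite lte_fin => I step.
pose c := J - (2 * Y) ^+ 2.
have c0 : 0 < c by rewrite subr_gt0.
pose del := Num.min 1 (c / (16 * (Y + 1))).
have Y1 : 0 < Y + 1 by lra.
have del0 : 0 < del by rewrite lt_min ltr01 divr_gt0// mulr_gt0.
have [dle1 dle] : del <= 1 /\ del * (16 * (Y + 1)) <= c.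
  by rewrite -ler_pdivlMr ?mulr_gt0//; split; rewrite /del ge_min lexx ?orbT.
have := step _ del0; rewrite lee_fin => HJ.
suff : (2 * (Y + del)) ^+ 2 < J by rewrite ltNge HJ.
have -> : J = c + (2 * Y) ^+ 2 by rewrite /c subrK.
exact: sqr_perturbation_lt.
Qed.

End DiskEstimate.

(** * Passage to the unit disk and the final constant *)

Section MainEstimate.
Variable R : realType.
Local Notation mu := (@lebesgue_measure R).
Local Open Scope classical_set_scope.
Local Open Scope complex_scope.
Variable f : R[i] -> R[i].

Lemma unit_disk_exhaustion : (@toC R @^-1` (@unit_disk R)) =
  \bigcup_n closed_disk (n.+1%:R / n.+2%:R).
Proof.
apply/seteqP; split => [p /mem_unit_disk p1|p [n _ pn]]; last first.
  apply/mem_unit_disk; apply: (le_lt_trans pn).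
  by rewrite expr_lt1 ?divr_ge0// ltr_pdivrMr// mul1r ltr_nat.
pose c := 1 - (p.1 ^+ 2 + p.2 ^+ 2).
have c0 : 0 < c by rewrite subr_gt0.
have := truncnS_gt (2 / c); set n := Num.trunc _ => nc.
exists n => //; rewrite /closed_disk/=.
have n0 : 0 < n.+1%:R :> R by [].
have n20 : 0 < n.+2%:R :> R by [].
have -> : n.+1%:R / n.+2%:R = 1 - n.+2%:R^-1 :> R.
  have -> : n.+1%:R = n.+2%:R - 1 :> R by rewrite -[n.+2%:R]natr1 addrK.
  by rewrite mulrBl divff ?gt_eqF// mul1r.
have -> : p.1 ^+ 2 + p.2 ^+ 2 = 1 - c by rewrite /c subKr.
(* With x = 1 / (n + 2), the goal 1 - c <= (1 - x)^2 follows from 2 x <= c; this is why n was taken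
   from 2 / c. *)
have h : n.+2%:R^-1 * 2 <= c.
  rewrite mulrC ler_pdivrMr//; move: nc; rewrite ltr_pdivrMr// => nc.
  rewrite -[n.+2%:R]natr1; nra.
move: (n.+2%:R^-1) h => x h; have := sqr_ge0 x; clearbody c; nra.
Qed.

Lemma hnorm_circle_bound (m rho : R) : 0 <= m -> 0 < rho < 1 ->
  (hnorm 4 f <= m%:E)%E ->
  (\int[mu]_(t in `[0%R, (2 * pi)%R]) (Normc.normc (f (circle rho t)) ^+ 4)%:E <=
   (2 * pi * m ^+ 4)%:E)%E.
Proof.
move=> m0 /andP[rho0 rho1] Hm.
have pi0 := pi_gt0 R; have pi20 : 0 < 2 * pi :> R by lra.
set J := (\int[mu]_(t in _) _)%E.
have J0 : (0 <= J)%E.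
  by apply: integral_ge0 => t _; rewrite lee_fin exprn_ge0// normc_nneg.
have : (((2 * pi)^-1%:E * J) `^ 4^-1 <= m%:E)%E.
  apply: le_trans Hm; apply: ereal_sup_ubound; exists rho; first by rewrite /= in_itv/= ltW.
  rewrite /circle_mean; congr (_ `^ _)%E; congr (_ * _)%E; apply: eq_integral => t _.
  rewrite powR_mulrn ?normc_nneg//; congr (Normc.normc (f _) ^+ _)%:E.
  by rewrite /circle; apply/eqP; rewrite eq_complex /= !mul0r subr0 addr0 !eqxx.
(* An infinite integral would make the circle mean infinite, above the real bound m. *)
case: J J0 => [j| |]//; last first.
  by move=> _; rewrite mulry gtr0_sg ?invr_gt0// mul1e poweRyr// leye_eq.
rewrite !lee_fin => j0 H.
have q0 : 0 <= (2 * pi)^-1 * j by rewrite mulr_ge0// invr_ge0 ltW.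
rewrite mulrC -ler_pdivrMr// mulrC.
have -> : (2 * pi)^-1 * j = ((2 * pi)^-1 * j) `^ 4^-1 ^+ 4.
  by rewrite -powR_mulrn ?powR_ge0// -powRrM mulVf ?pnatr_eq0// powRr1.
by apply: lerXn2r; rewrite ?nnegrE ?powR_ge0.
Qed.

Lemma area_bound (m : R) : 0 <= m -> harmonic_disk f -> (hnorm 4 f <= m%:E)%E ->
  (\int[mu \x mu]_(p in @toC R @^-1` (@unit_disk R)) (Normc.normc (f (toC p)) `^ 8)%:E <=
   ((4 * pi * m ^+ 4) ^+ 2)%:E)%E.
Proof.
move=> m0 hf Hm.
apply: (@ge0_integral_exhaustion _ (measurableTypeR R * measurableTypeR R)%type R
  (mu \x mu)%E _ _ (fun n => closed_disk (n.+1%:R / n.+2%:R : R))).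
- rewrite unit_disk_exhaustion; apply: bigcup_measurable => n _; exact: measurable_closed_disk.
- by move=> p _; rewrite lee_fin powR_ge0.
- apply/nondecreasing_seqP => n; apply/subsetPset => p /=; rewrite /closed_disk/= => H.
  apply: (le_trans H); apply: lerXn2r; rewrite ?nnegrE ?divr_ge0//.
  by rewrite ler_pdivrMr// mulrAC ler_pdivlMr// -!natrM ler_nat; lia.
- move=> n; exact: measurable_closed_disk.
- exact: unit_disk_exhaustion.
move=> n h Hh.
have rho01 : 0 < (n.+1%:R / n.+2%:R : R) < 1.
  by rewrite divr_gt0//= ltr_pdivrMr// mul1r ltr_nat.
have := disk_estimate hf rho01 (hnorm_circle_bound m0 rho01 Hm).
rewrite (_ : 2 * (2 * pi * m ^+ 4) = 4 * pi * m ^+ 4); last by ring.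
apply => p Kp; have := Hh p Kp; rewrite lee_fin powR_mulrn ?normc_nneg//.
Qed.

Lemma sin_le_id (x : R) : 0 <= x -> sin x <= x.
Proof.
move=> x0.
have [] := @MVT_segment R (fun y => y - sin y) (fun y => 1 - cos y) 0 x x0.
- apply: continuous_subspaceT => y; apply: cvgB; [exact: cvg_id|exact: continuous_sin].
move=> c _; rewrite sin0 !subr0 => E.
by rewrite -subr_ge0 E mulr_ge0// subr_ge0 cos_le1.
Qed.

Lemma bnorm_le (m : R) : 0 <= m -> harmonic_disk f -> (hnorm 4 f <= m%:E)%E ->
  (bnorm 8 f <= ((2 * sin (pi / 16))^-1 * m)%:E)%E.
Proof.
move=> m0 hf Hm; have pi0 := pi_gt0 R; have pi4 : pi < 4 :> R by have := pihalf_lt2 R; lra.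
have s0 : 0 < sin (pi / 16) :> R by rewrite sin_gt0_pi//; apply/andP; lra.
have s1 : sin (pi / 16) <= 4^-1 :> R.
  by apply: (le_trans (sin_le_id _)); lra.
set k := (2 * sin (pi / 16))^-1.
have k2 : 2 <= k.
  rewrite /k -[leLHS]invrK lef_pV2 ?posrE ?mulr_gt0 ?invr_gt0//; lra.
have k0 : 0 <= k by lra.
rewrite /bnorm.
(* Writing k * m as an eighth root lets the monotonicity of the power reduce the goal to the
   integrals. *)
apply: (@le_trans _ _ (((k * m) ^+ 8)%:E `^ 8^-1)%E); last first.
  rewrite poweR_EFin lee_fin -powR_mulrn ?mulr_ge0// -powRrM divff// powRr1// mulr_ge0//.
apply: gt0_ler_poweR; rewrite ?in_itv/= ?leey ?andbT ?invr_ge0//.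
- apply: mule_ge0; first by rewrite lee_fin invr_ge0 ltW.
  by apply: integral_ge0 => p _; rewrite lee_fin powR_ge0.
- by rewrite lee_fin exprn_ge0// mulr_ge0.
apply: (@le_trans _ _ (pi^-1%:E * ((4 * pi * m ^+ 4) ^+ 2)%:E)%E).
  apply: lee_wpmul2l; first by rewrite lee_fin invr_ge0 ltW.
  exact: area_bound.
rewrite -EFinM lee_fin.
have -> : pi^-1 * (4 * pi * m ^+ 4) ^+ 2 = 16 * pi * m ^+ 8.
  have -> : (4 * pi * m ^+ 4) ^+ 2 = pi * (16 * pi * m ^+ 8) by ring.
  by rewrite mulKf// gt_eqF.
rewrite exprMn ler_wpM2r ?exprn_ge0//.
apply: (@le_trans _ _ (2 ^+ 8)); last by apply: lerXn2r; rewrite ?nnegrE.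
have -> : 2 ^+ 8 = 256 :> R by rewrite -natrX.
lra.
Qed.

End MainEstimate.

Unset Implicit Arguments.

Theorem theorem1p2 (R : realType) (f : R[i] -> R[i])
    (fh4 : h_space 4 f)
    (fneq0 : exists2 z : R[i], unit_disk z & f z != 0) :
  b_space 8 f /\
  (bnorm 8 f <= (2 * sin (pi / 16))^-1%:E * hnorm 4 f)%E.
Proof.
have [hf h_lty] := fh4.
have h0 : (0 <= hnorm 4 f)%E.
  (* The supremum is over a nonempty set of nonnegative means; radius 0 supplies a member. *)
  apply: (@le_trans _ _ (circle_mean 4 f 0)); first exact: poweR_ge0.
  by apply: ereal_sup_ubound; exists 0 => //=; rewrite in_itv/= lexx ltr01.
have hfin : hnorm 4 f \is a fin_num by rewrite ge0_fin_numE.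
have H : (bnorm 8 f <= ((2 * sin (pi / 16))^-1 * fine (hnorm 4 f))%:E)%E.
  by apply: bnorm_le => //; rewrite ?fine_ge0// fineK.
split; first by split=> //; apply: le_lt_trans H _; rewrite ltry.
by rewrite -(fineK hfin) -EFinM.
Qed.
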